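(* Let $X$ be a Polish space, $h:X\to\mathbb R$, and let $\kappa$ be a nonzero countable ordinal with $\kappa\sim(\xi,\alpha)$. Then $h\in\mathcal M(\kappa,\kappa)$ if and only if $\bigcap_{M>0}h_M^{\omega^\kappa}(X)=\emptyset$ and $\Omega^{\omega^\alpha}_{h,\xi}(X)=\emptyset$.
   Context: Oscillation rank: for $f:X\to\mathbb R$, $\varepsilon>0$ and closed $F$, $D^0(f,\varepsilon,F)=F$, $D^1(f,\varepsilon,F)$ = set of $x\in F$ such that every neighbourhood $U$ of $x$ contains $x_1,x_2\in F\cap U$ with $|f(x_1)-f(x_2)|\ge\varepsilon$, iterated transfinitely with intersections at limits; $\beta(f)=\sup_{\varepsilon>0}\beta(f,\varepsilon)$ where $\beta(f,\varepsilon)$ is the least $\alpha$ with $D^\alpha(f,\varepsilon,X)=\emptyset$ ($\omega_1$ if none). $\mathfrak B_1^\lambda(X)=\{f\in\mathfrak B_1(X):\beta(f)\le\omega^\lambda\}$ for countable $\lambda$. $\mathcal M(\kappa,\lambda)$ is the set of $h:X\to\mathbb R$ such that $hf\in\mathfrak B_1^\lambda(X)$ whenever $f\in\mathfrak B_1^\kappa(X)$. A derivation is a map $\delta$ from closed sets to closed sets with $\delta(P)\subseteq P$; iterates: $\delta^0(P)=P$, $\delta^{\alpha+1}(P)=\delta(\delta^\alpha(P))$, $\delta^\alpha(P)=\bigcap_{\alpha'<\alpha}\delta^{\alpha'}(P)$ for limit $\alpha$. $A'$ denotes the set of accumulation points of $A$ in $X$. For $M\ge0$, $h_M(P)=(P\cap\{|h|>M\})'$.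 For closed $P$ and $\varepsilon>0$, $O(h,\varepsilon,P)$ is the set of $x\in P$ such that every neighbourhood $U$ of $x$ contains $y\in U\cap P$ with $|h(y)-h(x)|\ge\varepsilon$, and $\delta(h,\varepsilon,P)=\overline{O(h,\varepsilon,P)}$. For each countable ordinal $\xi$ a sequence $(\xi_n)$ of ordinals strictly increasing to $\omega^{\omega^\xi}$ is fixed, and $\Omega_{h,\xi}(P)=\bigcap_n\big[\bigcup_{\eta>0}\delta^{\xi_n}(h,\eta,P)\big]'$. For nonzero countable $\kappa$ with Cantor normal form $\kappa=\omega^{\kappa_1}m_1+\dots+\omega^{\kappa_k}m_k$ ($\kappa_1>\dots>\kappa_k$, $m_i\in\mathbb N$), write $\kappa\sim(\xi,\alpha)$ where $\xi=\kappa_1$ and $\alpha=\omega^{\kappa_1}(m_1-1)+\omega^{\kappa_2}m_2+\dots+\omega^{\kappa_k}m_k$ (so $\kappa=\omega^\xi+\alpha$). *)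

(* Defs.v *)
From Stdlib Require Import Reals List.
Open Scope R_scope.

Record PolishSpace := {
  pt :> Type;
  pdist : pt -> pt -> R;
  pdist_nonneg : forall x y, 0 <= pdist x y;
  pdist_eq0 : forall x y, pdist x y = 0 <-> x = y;
  pdist_sym : forall x y, pdist x y = pdist y x;
  pdist_tri : forall x y z, pdist x z <= pdist x y + pdist y z;
  (* separable: a countable dense subset (possibly empty) *)
  p_separable : exists D : nat -> option pt,
      forall x eps, 0 < eps -> exists n y, D n = Some y /\ pdist x y < eps;
  p_complete : forall u : nat -> pt,
      (forall eps, 0 < eps -> exists N, forall n m, (n >= N)%nat -> (m >= N)%nat ->
          pdist (u n) (u m) < eps) ->
      exists l, forall eps, 0 < eps -> exists N, forall n, (n >= N)%nat -> pdist (u n) l < eps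
}.

Section Topo.
Variable X : PolishSpace.

Definition closure (A : X -> Prop) : X -> Prop :=
  fun x => forall r, 0 < r -> exists y, A y /\ pdist X x y < r.

Definition accum (A : X -> Prop) : X -> Prop :=
  fun x => forall r, 0 < r -> exists y, A y /\ y <> x /\ pdist X x y < r.

Definition continuous (f : X -> R) : Prop :=
  forall x eps, 0 < eps -> exists delta, 0 < delta /\
    forall y, pdist X x y < delta -> Rabs (f x - f y) < eps.

Definition Baire1 (f : X -> R) : Prop :=
  exists fn : nat -> X -> R, (forall n, continuous (fn n)) /\
    forall x, Un_cv (fun n => fn n x) (f x).
End Topo.

(* Countable ordinals as Brouwer trees.                               *)
Inductive ord : Type :=
| OZ : ord
| OS : ord -> ord
| OL : (nat -> ord) -> ord.   (* supremum of a sequence *)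

(* extensional (set-theoretic) order on Brouwer trees *)
Inductive ord_le : ord -> ord -> Prop :=
| ole_Z : forall b, ord_le OZ b
| ole_SS : forall a b, ord_le a b -> ord_le (OS a) (OS b)
| ole_Sr : forall a b, ord_le a b -> ord_le a (OS b)
| ole_Ll : forall f b, (forall n, ord_le (f n) b) -> ord_le (OL f) b
| ole_Lr : forall a f n, ord_le a (f n) -> ord_le a (OL f).

Definition ord_lt (a b : ord) : Prop := ord_le (OS a) b.
Definition ord_eq (a b : ord) : Prop := ord_le a b /\ ord_le b a.

Fixpoint fin (n : nat) : ord :=
  match n with O => OZ | S k => OS (fin k) end.

Definition omega : ord := OL fin.

Fixpoint oadd (a b : ord) : ord :=
  match b with
  | OZ => a
  | OS b' => OS (oadd a b')
  | OL f => OL (fun n => oadd a (f n))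
  end.

Fixpoint omul (a b : ord) : ord :=
  match b with
  | OZ => OZ
  | OS b' => oadd (omul a b') a
  | OL f => OL (fun n => omul a (f n))
  end.

Fixpoint oexp (b : ord) : ord :=
  match b with
  | OZ => OS OZ
  | OS b' => omul (oexp b') omega
  | OL f => OL (fun n => oexp (f n))
  end.

Fixpoint cnf_eval (l : list (ord * nat)) : ord :=
  match l with
  | nil => OZ
  | (e, m) :: r => oadd (omul (oexp e) (fin m)) (cnf_eval r)
  end.

Fixpoint cnf_valid (l : list (ord * nat)) : Prop :=
  match l with
  | nil => True
  | (e, m) :: r =>
      (1 <= m)%nat /\
      (match r with nil => True | (e', _) :: _ => ord_lt e' e end) /\
      cnf_valid r
  end.

Definition cnf_sim (kappa xi alpha : ord) : Prop :=
  exists (k1 : ord) (m1 : nat) (rest : list (ord * nat)),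
    cnf_valid ((k1, m1) :: rest) /\
    ord_eq kappa (cnf_eval ((k1, m1) :: rest)) /\
    ord_eq xi k1 /\
    ord_eq alpha (oadd (omul (oexp k1) (fin (m1 - 1))) (cnf_eval rest)).

Fixpoint iter {T : Type} (d : (T -> Prop) -> (T -> Prop)) (a : ord) (P : T -> Prop)
  : T -> Prop :=
  match a with
  | OZ => P
  | OS b => d (iter d b P)
  | OL f => fun x => forall n, iter d (f n) P x
  end.

Section Ranks.
Variable X : PolishSpace.

Definition fullset : X -> Prop := fun _ => True.

Definition Dosc (f : X -> R) (eps : R) (F : X -> Prop) : X -> Prop :=
  fun x => F x /\ forall r, 0 < r -> exists x1 x2,
      F x1 /\ F x2 /\ pdist X x x1 < r /\ pdist X x x2 < r /\ eps <= Rabs (f x1 - f x2).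

(* beta(f) <= gamma, i.e. for each eps > 0 the least alpha with
   D^alpha(f,eps,X) = empty is <= gamma *)
Definition beta_le (f : X -> R) (gamma : ord) : Prop :=
  forall eps, 0 < eps -> exists a, ord_le a gamma /\
    forall x, ~ iter (Dosc f eps) a fullset x.

Definition B1 (lambda : ord) (f : X -> R) : Prop :=
  Baire1 X f /\ beta_le f (oexp lambda).

Definition Mclass (kappa lambda : ord) (h : X -> R) : Prop :=
  forall f : X -> R, B1 kappa f -> B1 lambda (fun x => h x * f x).

Definition hM (h : X -> R) (M : R) (P : X -> Prop) : X -> Prop :=
  accum X (fun x => P x /\ M < Rabs (h x)).

Definition Oset (h : X -> R) (eps : R) (P : X -> Prop) : X -> Prop :=
  fun x => P x /\ forall r, 0 < r -> exists y, P y /\ pdist X x y < r /\ eps <= Rabs (h y - h x).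

Definition delta (h : X -> R) (eps : R) (P : X -> Prop) : X -> Prop :=
  closure X (Oset h eps P).

(* Omega_{h,xi}(P) with the fixed sequence s = (xi_n) *)
Definition Omega (h : X -> R) (s : nat -> ord) (P : X -> Prop) : X -> Prop :=
  fun x => forall n,
    accum X (fun y => exists eta, 0 < eta /\ iter (delta h eta) (s n) P y) x.
End Ranks.

(* Main.v *)
(** On closed sets the operators [delta] and [hM] distribute over finite unions, and
    [Dosc f (2 e) <= delta f e <= Dosc f e], so [beta f <= omega^lambda] means that every
    [delta f e] dies out after [omega^lambda] steps; such an [f] is automatically Baire one.
    If a derivation [c] distributing over finite unions satisfies [c P <= d P \/ e P], then the
    same inclusion holds for the [omega^lambda]-th iterates.

    Sufficiency: [h y f y - h x f x = h y (f y - f x) + f x (h y - h x)] bounds the derivation of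
    [h f] by [hM], the derivation of [f], and the derivation [G] attached to
    [eps <= |f x| |h y - h x|].  Off [delta f 1] the function [f] is locally bounded, so there [G]
    is controlled by some [delta h eta]; since [a * omega^(omega^xi) <= omega^(omega^xi)] for
    [a < omega^(omega^xi)], the [omega^(omega^xi)]-th iterate of [G] is contained in the union of
    [Omega] and the [omega^(omega^xi)]-th iterate of [delta f 1].

    Necessity: a point surviving one of the two iterated derivations is the root of a
    well-founded tree of points, the children of a node converging to it inside disjoint balls.
    If [x] survives [hM] for all [M], put [f = 1/h] on alternate levels of such trees, with
    [M -> oo] along the children of [x], so that [f] is small near [x].  If [x] survives [Omega],
    give [f] the constant value [2/eta] on the part of the tree witnessing
    [delta h eta] and change [eta] only at the [Omega]-steps; then [f] has rank at most
    [omega^alpha + 2 <= omega^kappa], because [alpha < kappa]. *)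

Require Import Defs.
From Stdlib Require Import Reals List Lra Lia Classical ClassicalEpsilon.
Open Scope R_scope.

(** * Brouwer-tree ordinals *)

Lemma ord_le_refl a : ord_le a a.
Proof.
  induction a as [|a IH|f IH].
  - constructor.
  - now apply ole_SS.
  - apply ole_Ll; intro n; now apply ole_Lr with n.
Qed.

Lemma ord_le_S_l a b : ord_le (OS a) b -> ord_le a b.
Proof.
  intro H; remember (OS a) as a' eqn:E; revert a E.
  induction H; intros a' E; try discriminate.
  - injection E as <-; now apply ole_Sr.
  - apply ole_Sr; auto.
  - apply ole_Lr with n; auto.
Qed.

Lemma ord_le_L_l f b : ord_le (OL f) b -> forall n, ord_le (f n) b.
Proof.
  intro H; remember (OL f) as a eqn:E; revert f E.
  induction H as [| | |f b H _|a g n H IH]; intros f' E m; try discriminate.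
  - apply ole_Sr; auto.
  - injection E as ->; auto.
  - apply ole_Lr with n; auto.
Qed.

Lemma ord_le_trans a b c : ord_le a b -> ord_le b c -> ord_le a c.
Proof.
  intro H; revert c.
  induction H as [|a b H IH|a b H IH|f b H IH|a f n H IH]; intros c Hc.
  - constructor.
  - remember (OS b) as b' eqn:E; induction Hc; try discriminate.
    + injection E as ->; apply ole_SS; auto.
    + apply ole_Sr; auto.
    + apply ole_Lr with n; auto.
  - apply IH, ord_le_S_l; auto.
  - apply ole_Ll; auto.
  - apply IH; eapply ord_le_L_l; eauto.
Qed.

Lemma ord_le_SS_inv a b : ord_le (OS a) (OS b) -> ord_le a b.
Proof. intro H; inversion H; subst; auto using ord_le_S_l. Qed.

Lemma ord_le_S_L_inv a f : ord_le (OS a) (OL f) -> exists n, ord_le (OS a) (f n).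
Proof. intro H; inversion H; subst; eauto. Qed.

Lemma ord_le_S a : ord_le a (OS a).
Proof. apply ole_Sr, ord_le_refl. Qed.

Lemma ord_le_L f n : ord_le (f n) (OL f).
Proof. apply ole_Lr with n, ord_le_refl. Qed.

Lemma ord_le_LL f g : (forall n, exists m, ord_le (f n) (g m)) -> ord_le (OL f) (OL g).
Proof. intro H; apply ole_Ll; intro n; destruct (H n) as [m Hm]; now apply ole_Lr with m. Qed.

#[local] Hint Resolve ord_le_refl ord_le_S ord_le_L ole_Z ole_SS : ordb.

(** In each supremum case excluded middle decides whether some member of the sequence already
    exceeds the other ordinal. *)
Lemma ord_le_total a b : ord_le a b \/ ord_le (OS b) a.
Proof.
  revert b; induction a as [|a IH|f IH]; intro b.
  - left; constructor.
  - induction b as [|b _|g IHg].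
    + right; auto with ordb.
    + destruct (IH b); [left|right]; now apply ole_SS.
    + destruct (classic (exists n, ord_le (OS a) (g n))) as [[n H]|N].
      * left; now apply ole_Lr with n.
      * right; apply ole_SS, ole_Ll; intro n.
        destruct (IHg n); [exfalso; eauto|now apply ord_le_SS_inv].
  - destruct (classic (exists n, ord_le (OS b) (f n))) as [[n H]|N].
    + right; now apply ole_Lr with n.
    + left; apply ole_Ll; intro n; destruct (IH n b); [auto|exfalso; eauto].
Qed.

(** Accessibility is claimed for everything below a bound and the induction runs on the bound, since
    an ordinal smaller in the extensional order need not be a subtree. *)
Lemma ord_lt_wf : well_founded ord_lt.
Proof.
  assert (H : forall b a, ord_le a b -> Acc ord_lt a).
  { induction b as [|b IH|f IH]; intros a Ha; constructor; intros c Hc;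
      pose proof (ord_le_trans _ _ _ Hc Ha) as H.
    - inversion H.
    - now apply IH, ord_le_SS_inv.
    - destruct (ord_le_S_L_inv _ _ H) as [n Hn].
      destruct (IH n _ Hn) as [K]; apply K; apply ord_le_refl. }
  intro a; apply (H a), ord_le_refl.
Qed.

Definition omax (a b : ord) : ord := if excluded_middle_informative (ord_le a b) then b else a.

Lemma omax_l a b : ord_le a (omax a b).
Proof. unfold omax; destruct excluded_middle_informative; auto with ordb. Qed.

Lemma omax_r a b : ord_le b (omax a b).
Proof.
  unfold omax; destruct excluded_middle_informative as [|N]; auto with ordb.
  destruct (ord_le_total a b) as [|H]; [contradiction|now apply ord_le_S_l].
Qed.

Fixpoint omax_upto (f : nat -> ord) (n : nat) : ord :=
  match n with O => f O | S k => omax (omax_upto f k) (f (S k)) end.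

Definition nondecr (b : nat -> ord) : Prop := forall n m, (n <= m)%nat -> ord_le (b n) (b m).

Lemma nondecr_step b : (forall n, ord_le (b n) (b (S n))) -> nondecr b.
Proof. intros H n m Hnm; induction Hnm; [apply ord_le_refl|eapply ord_le_trans; eauto]. Qed.

Lemma omax_upto_in f n : exists m, omax_upto f n = f m.
Proof.
  induction n as [|n [m IH]]; simpl; [now exists O|].
  unfold omax; destruct excluded_middle_informative; [now exists (S n)|now exists m].
Qed.

Lemma omax_upto_ge f n : ord_le (f n) (omax_upto f n).
Proof. destruct n; simpl; [apply ord_le_refl|apply omax_r]. Qed.

(** Treats successors and limits alike: in the tree constructions a node of rank [a] gets children
    of ranks [b k]. If a supremum is attained, the member attaining it is decomposed; otherwise
    every running maximum lies strictly below it, and these maxima serve as [b]. *)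
Lemma ord_decomp a :
  ord_le a OZ \/ exists b, nondecr b /\ ord_eq a (OL (fun k => OS (b k))).
Proof.
  induction a as [|a _|f IH].
  - left; constructor.
  - right; exists (fun _ => a); split; [intros n m _; apply ord_le_refl|split].
    + apply ole_Lr with O, ord_le_refl.
    + apply ole_Ll; intros _; apply ord_le_refl.
  - destruct (classic (exists n, ord_le (OL f) (f n))) as [[n Hn]|N].
    + destruct (IH n) as [H|[b [Hb [H1 H2]]]].
      * left; eapply ord_le_trans; eauto.
      * right; exists b; split; [auto|split].
        -- eapply ord_le_trans; eauto.
        -- eapply ord_le_trans; [exact H2|apply ord_le_L].
    + right; exists (omax_upto f); split; [|split].
      * apply nondecr_step; intro n; apply omax_l.
      * apply ord_le_LL; intro n; exists n.
        eapply ord_le_trans; [apply omax_upto_ge|apply ord_le_S].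
      * apply ole_Ll; intro n; destruct (omax_upto_in f n) as [m ->].
        destruct (ord_le_total (OL f) (f m)); [exfalso; eauto|auto].
Qed.

Lemma oadd_le_l a a' b : ord_le a a' -> ord_le (oadd a b) (oadd a' b).
Proof.
  intro H; induction b as [|b IH|f IH]; simpl; auto with ordb.
  apply ord_le_LL; intro n; eauto.
Qed.

Lemma oadd_ge_l a b : ord_le a (oadd a b).
Proof.
  induction b as [|b IH|f IH]; simpl; auto with ordb.
  - now apply ole_Sr.
  - now apply ole_Lr with O.
Qed.

Lemma oadd_le_r a b b' : ord_le b b' -> ord_le (oadd a b) (oadd a b').
Proof.
  induction 1; simpl; auto with ordb.
  - apply oadd_ge_l.
  - now apply ole_Sr.
  - now apply ole_Ll.
  - now apply ole_Lr with n.
Qed.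

Lemma oadd_le a a' b b' : ord_le a a' -> ord_le b b' -> ord_le (oadd a b) (oadd a' b').
Proof. intros; eapply ord_le_trans; [apply oadd_le_l|apply oadd_le_r]; eauto. Qed.

Lemma oadd_ge_r a b : ord_le b (oadd a b).
Proof.
  induction b as [|b IH|f IH]; simpl; auto with ordb.
  apply ord_le_LL; eauto.
Qed.

Lemma oadd_0_l b : ord_le (oadd OZ b) b.
Proof.
  induction b as [|b IH|f IH]; simpl; auto with ordb.
  apply ord_le_LL; eauto.
Qed.

Lemma oadd_assoc a b c : ord_eq (oadd a (oadd b c)) (oadd (oadd a b) c).
Proof.
  induction c as [|c [H1 H2]|f IH]; simpl.
  - split; apply ord_le_refl.
  - split; now apply ole_SS.
  - split; apply ord_le_LL; intro n; exists n; apply IH.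
Qed.

Lemma omul_le_l a a' b : ord_le a a' -> ord_le (omul a b) (omul a' b).
Proof.
  intro H; induction b as [|b IH|f IH]; simpl; auto with ordb.
  - now apply oadd_le.
  - apply ord_le_LL; eauto.
Qed.

Lemma omul_le_r a b b' : ord_le b b' -> ord_le (omul a b) (omul a b').
Proof.
  induction 1; simpl; auto with ordb.
  - now apply oadd_le_l.
  - eapply ord_le_trans; [exact IHord_le|apply oadd_ge_l].
  - now apply ole_Ll.
  - now apply ole_Lr with n.
Qed.

Lemma omul_oadd a b c : ord_eq (omul a (oadd b c)) (oadd (omul a b) (omul a c)).
Proof.
  induction c as [|c [H1 H2]|f IH]; simpl.
  - split; apply ord_le_refl.
  - destruct (oadd_assoc (omul a b) (omul a c) a) as [K1 K2].
    split.
    + eapply ord_le_trans; [apply oadd_le_l, H1|exact K2].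
    + eapply ord_le_trans; [exact K1|apply oadd_le_l, H2].
  - split; apply ord_le_LL; intro n; exists n; apply IH.
Qed.

Lemma omul_assoc a b c : ord_eq (omul a (omul b c)) (omul (omul a b) c).
Proof.
  induction c as [|c [H1 H2]|f IH]; simpl.
  - split; apply ord_le_refl.
  - destruct (omul_oadd a (omul b c) b) as [K1 K2].
    split.
    + eapply ord_le_trans; [exact K1|now apply oadd_le_l].
    + eapply ord_le_trans; [|exact K2]; now apply oadd_le_l.
  - split; apply ord_le_LL; intro n; exists n; apply IH.
Qed.

Lemma omul_1_r a : ord_eq (omul a (fin 1)) a.
Proof. simpl; split; [apply oadd_0_l|apply oadd_ge_r]. Qed.

Lemma oexp_le a b : ord_le a b -> ord_le (oexp a) (oexp b).
Proof.
  assert (K : forall c, ord_le (oexp c) (omul (oexp c) omega)).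
  { intro c; eapply ord_le_trans; [apply (omul_1_r (oexp c))|].
    apply omul_le_r, (ord_le_L fin 1). }
  induction 1; cbn [oexp].
  - induction b as [|b IH|f IH]; cbn [oexp].
    + apply ord_le_refl.
    + eapply ord_le_trans; [exact IH|apply K].
    + apply ole_Lr with O, IH.
  - now apply omul_le_l.
  - eapply ord_le_trans; [exact IHord_le|apply K].
  - now apply ole_Ll.
  - now apply ole_Lr with n.
Qed.

Lemma oexp_ge_1 a : ord_le (OS OZ) (oexp a).
Proof. apply (oexp_le OZ a); constructor. Qed.

Lemma oexp_oadd a b : ord_eq (oexp (oadd a b)) (omul (oexp a) (oexp b)).
Proof.
  induction b as [|b [H1 H2]|f IH]; cbn [oexp oadd].
  - destruct (omul_1_r (oexp a)); now split.
  - destruct (omul_assoc (oexp a) (oexp b) omega) as [K1 K2].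
    split.
    + eapply ord_le_trans; [|exact K2]; now apply omul_le_l.
    + eapply ord_le_trans; [exact K1|]; now apply omul_le_l.
  - split; apply ord_le_LL; intro n; exists n; apply IH.
Qed.

Lemma fin_add n m : oadd (fin n) (fin m) = fin (m + n).
Proof. induction m as [|m IH]; simpl; congruence. Qed.

Lemma fin_mul n m : omul (fin n) (fin m) = fin (m * n).
Proof.
  induction m as [|m IH]; [reflexivity|].
  change (oadd (omul (fin n) (fin m)) (fin n) = fin (S m * n)).
  rewrite IH, fin_add; f_equal; lia.
Qed.

Lemma lt_omul_omega a b : ord_lt a (omul b omega) -> exists n, ord_le a (omul b (fin n)).
Proof.
  intro H; destruct (ord_le_S_L_inv _ _ H) as [n Hn].
  exists n; now apply ord_le_S_l.
Qed.

(** Additive indecomposability of omega^e. At a successor, a <= omega^e n gives a + omega^e k <=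
    omega^e (n + k). *)
Lemma oexp_add_absorb e a : ord_lt a (oexp e) -> ord_le (oadd a (oexp e)) (oexp e).
Proof.
  revert a; induction e as [|e IH|f IH]; intros a Ha.
  - apply ord_le_SS_inv in Ha; cbn. apply ole_SS; exact Ha.
  - destruct (lt_omul_omega _ _ Ha) as [n Hn].
    cbn [oexp]; apply ole_Ll; intro k.
    apply ole_Lr with (k + n)%nat.
    eapply ord_le_trans; [apply oadd_le_l, Hn|].
    eapply ord_le_trans; [apply omul_oadd|].
    rewrite fin_add; apply ord_le_refl.
  - destruct (ord_le_S_L_inv _ _ Ha) as [n Hn].
    cbn [oexp oadd]; apply ole_Ll; intro m.
    (* The sequence under [OL] need not increase, so the induction hypothesis is used at whichever
       of the two indices has the larger exponent. *)
    destruct (ord_le_total (f n) (f m)) as [H|H].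
    + apply ole_Lr with m, IH.
      eapply ord_le_trans; [exact Hn|now apply oexp_le].
    + apply ole_Lr with n.
      eapply ord_le_trans; [|apply (IH n _ Hn)].
      apply oadd_le_r, oexp_le; now apply ord_le_S_l.
Qed.

(** Multiplicative indecomposability of omega^(omega^e). The base case is a product of finite
    ordinals; at a successor, a <= omega^(omega^e n), and multiplying adds exponents, so omega^e n
    is absorbed by omega^(e+1). *)
Lemma oexp_oexp_mul_absorb e a :
  ord_lt a (oexp (oexp e)) -> ord_le (omul a (oexp (oexp e))) (oexp (oexp e)).
Proof.
  revert a; induction e as [|e IH|f IH]; intros a Ha.
  - destruct (lt_omul_omega _ _ Ha) as [n Hn].
    assert (Hn' : ord_le a (fin n)).
    { eapply ord_le_trans; [exact Hn|]. change (ord_le (omul (fin 1) (fin n)) (fin n)).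
      rewrite fin_mul, Nat.mul_1_r; apply ord_le_refl. }
    change (ord_le (omul a (omul (fin 1) omega)) (omul (fin 1) omega)).
    simpl. apply ole_Ll; intro k.
    apply ole_Lr with (k * n)%nat.
    change (ord_le (omul a (omul (fin 1) (fin k))) (omul (fin 1) (fin (k * n)))).
    rewrite !fin_mul, !Nat.mul_1_r.
    eapply ord_le_trans; [apply omul_le_l, Hn'|].
    rewrite fin_mul; apply ord_le_refl.
  - cbn [oexp omul omega] in Ha.
    destruct (ord_le_S_L_inv _ _ Ha) as [n Hn]; apply ord_le_S_l in Hn.
    eapply ord_le_trans; [apply omul_le_l, Hn|].
    eapply ord_le_trans; [apply oexp_oadd|].
    apply oexp_le; cbn [oexp].
    apply ole_Ll; intro k; apply ole_Lr with (k + n)%nat.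
    eapply ord_le_trans; [apply omul_oadd|].
    rewrite fin_add; apply ord_le_refl.
  - destruct (ord_le_S_L_inv _ _ Ha) as [n Hn].
    cbn [oexp omul]; apply ole_Ll; intro m.
    destruct (ord_le_total (f n) (f m)) as [H|H].
    + apply ole_Lr with m, IH.
      eapply ord_le_trans; [exact Hn|now apply oexp_le, oexp_le].
    + apply ole_Lr with n.
      eapply ord_le_trans; [|apply (IH n _ Hn)].
      apply omul_le_r, oexp_le, oexp_le; now apply ord_le_S_l.
Qed.

Lemma omul_fin_S a n : ord_eq (omul a (fin (S n))) (oadd a (omul a (fin n))).
Proof.
  replace (S n) with (n + 1)%nat by lia; rewrite <- (fin_add 1 n).
  destruct (omul_oadd a (fin 1) (fin n)) as [H1 H2], (omul_1_r a) as [K1 K2].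
  split.
  - eapply ord_le_trans; [exact H1|now apply oadd_le_l].
  - eapply ord_le_trans; [|exact H2]; now apply oadd_le_l.
Qed.

(** Inductively omega^e' m' + tail < omega^e' (m' + 1) <= omega^(e'+1) <= omega^e. *)
Lemma cnf_eval_lt e m r : cnf_valid ((e, m) :: r) -> ord_lt (cnf_eval r) (oexp e).
Proof.
  revert e m; induction r as [|[e' m'] r IH]; intros e m H.
  - apply oexp_ge_1.
  - destruct H as [_ [He Hv]].
    pose proof (IH _ _ Hv) as Hr.
    eapply ord_le_trans; [|apply oexp_le, He].
    cbn [cnf_eval oexp].
    apply ole_Lr with (S m').
    change (OS (oadd (omul (oexp e') (fin m')) (cnf_eval r)))
      with (oadd (omul (oexp e') (fin m')) (OS (cnf_eval r))).
    apply oadd_le_r, Hr.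
Qed.

(** The two facts about the normal form on which the rest relies. The strict inequality holds
    because [alpha] has one copy of the leading power fewer, and the tail is smaller than such a
    copy. *)
Lemma cnf_sim_split kappa xi alpha :
  cnf_sim kappa xi alpha -> ord_eq kappa (oadd (oexp xi) alpha) /\ ord_lt alpha kappa.
Proof.
  intros (k1 & m1 & rest & Hv & [Hk1 Hk2] & [Hx1 Hx2] & [Ha1 Ha2]).
  pose proof (cnf_eval_lt _ _ _ Hv) as Hr.
  destruct Hv as [Hm _]; destruct m1 as [|m]; [lia|].
  replace (S m - 1)%nat with m in * by lia.
  cbn [cnf_eval] in *.
  destruct (omul_fin_S (oexp k1) m) as [E1 E2].
  destruct (oadd_assoc (oexp k1) (omul (oexp k1) (fin m)) (cnf_eval rest)) as [A1 A2].
  split; [split|].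
  - eapply ord_le_trans; [exact Hk1|].
    eapply ord_le_trans; [apply oadd_le_l, E1|].
    eapply ord_le_trans; [exact A2|].
    apply oadd_le; [now apply oexp_le|auto].
  - eapply ord_le_trans; [|exact Hk2].
    eapply ord_le_trans; [|apply oadd_le_l, E2].
    eapply ord_le_trans; [|exact A1].
    apply oadd_le; [now apply oexp_le|auto].
  - eapply ord_le_trans; [|exact Hk2].
    eapply ord_le_trans; [apply ole_SS, Ha1|].
    eapply ord_le_trans; [|apply oadd_ge_l].
    exact (oadd_le_r (omul (oexp k1) (fin m)) _ _ Hr).
Qed.

(** Since 1 <= omega^a, the ordinal omega^a + 2 fits into three copies of omega^a. This pays for the
    two extra steps in the rank of the function built from [Omega]. *)
Lemma oexp_add_2_le a b : ord_lt a b -> ord_le (OS (OS (oexp a))) (oexp b).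
Proof.
  intro H; eapply ord_le_trans; [|apply oexp_le, H].
  cbn [oexp]; apply ole_Lr with 3%nat; cbn [fin omul].
  change (OS (OS (oexp a))) with (oadd (oadd (oexp a) (OS OZ)) (OS OZ)).
  apply oadd_le; [apply oadd_le|]; try apply oexp_ge_1.
  apply oadd_ge_r.
Qed.

(** By absorption a + omega^k <= omega^k, and 2 <= omega^k as soon as k is nonzero; omega^0 = 1 is
    the exception. *)
Lemma oexp_limit k a : ~ ord_eq k OZ -> ord_lt a (oexp k) -> ord_le (OS (OS a)) (oexp k).
Proof.
  intros Hk Ha.
  eapply ord_le_trans; [|apply oexp_add_absorb, Ha].
  change (OS (OS a)) with (oadd a (OS (OS OZ))); apply oadd_le_r.
  destruct (ord_le_total k OZ) as [H|H]; [exfalso; apply Hk; split; auto with ordb|].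
  eapply ord_le_trans; [|apply (oexp_add_2_le _ _ H)].
  apply ole_SS, ole_SS; constructor.
Qed.

(** * Derivations on closed sets *)

Definition incl {T : Type} (P Q : T -> Prop) : Prop := forall x, P x -> Q x.
Definition union {T : Type} (P Q : T -> Prop) : T -> Prop := fun x => P x \/ Q x.

Lemma iter_oadd {T : Type} (d : (T -> Prop) -> T -> Prop) a b P x :
  (forall P Q, incl P Q -> incl (d P) (d Q)) ->
  iter d (oadd a b) P x <-> iter d b (iter d a P) x.
Proof.
  intro mono; revert x; induction b as [|b IH|f IH]; intro x; simpl.
  - reflexivity.
  - split; apply mono; intro y; apply IH.
  - split; intros H n; now apply IH.
Qed.

(** Cuts the iteration into [b] blocks of length [a]; it is applied with omega^kappa =
    omega^(omega^xi) omega^alpha. *)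
Lemma iter_omul {T : Type} (d : (T -> Prop) -> T -> Prop) a b P x :
  (forall P Q, incl P Q -> incl (d P) (d Q)) ->
  iter d (omul a b) P x <-> iter (iter d a) b P x.
Proof.
  intro mono.
  assert (mono_iter : forall P Q, incl P Q -> incl (iter d a P) (iter d a Q)).
  { clear -mono; intros P Q H; induction a as [|a IH|f IH]; simpl; auto.
    intros x Hx n; apply IH; auto. }
  revert x; induction b as [|b IH|f IH]; intro x; simpl.
  - reflexivity.
  - rewrite iter_oadd by exact mono; split; apply mono_iter; intro y; apply IH.
  - split; intros H n; now apply IH.
Qed.

Section Derivations.
Variable X : PolishSpace.
Implicit Types (P Q : X -> Prop) (d : (X -> Prop) -> X -> Prop).

Lemma pdist_refl (x : X) : pdist X x x = 0.
Proof. now apply pdist_eq0. Qed.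

Lemma pdist_pos (x y : X) : x <> y -> 0 < pdist X x y.
Proof.
  intro H; destruct (pdist_nonneg X x y) as [|E]; auto.
  symmetry in E; apply pdist_eq0 in E; contradiction.
Qed.

Definition closed P : Prop := incl (closure X P) P.

Lemma closure_incl P : incl P (closure X P).
Proof. intros x Hx r Hr; exists x; rewrite pdist_refl; auto. Qed.

Lemma closure_mono P Q : incl P Q -> incl (closure X P) (closure X Q).
Proof. intros H x Hx r Hr; destruct (Hx r Hr) as (y & Hy & Hd); exists y; auto. Qed.

Lemma closed_closure P : closed (closure X P).
Proof.
  intros x Hx r Hr.
  destruct (Hx (r / 2)) as (y & Hy & Hd); [lra|].
  destruct (Hy (r / 2)) as (z & Hz & Hd'); [lra|].
  exists z; split; auto; pose proof (pdist_tri X x y z); lra.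
Qed.

Lemma closed_accum P : closed (accum X P).
Proof.
  intros x Hx r Hr.
  destruct (Hx (r / 2)) as (y & Hy & Hd); [lra|].
  destruct (classic (y = x)) as [->|N].
  - apply Hy; lra.
  - assert (Hp : 0 < pdist X y x) by now apply pdist_pos.
    destruct (Hy (pdist X y x)) as (z & Hz & Hn & Hd'); auto.
    exists z; split; [auto|split].
    + intros ->; lra.
    + pose proof (pdist_tri X x y z); rewrite (pdist_sym X y x) in Hd'; lra.
Qed.

Lemma closed_full : closed (fullset X).
Proof. now intros x _. Qed.

Lemma not_closed_ball P x : closed P -> ~ P x ->
  exists r, 0 < r /\ forall y, pdist X x y < r -> ~ P y.
Proof.
  intros HP Hx; apply NNPP; intro N; apply Hx, HP; intros r Hr.
  apply NNPP; intro N'; apply N; exists r; split; auto.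
  intros y Hy HPy; eauto.
Qed.

Lemma closed_single x : closed (fun y => y = x).
Proof.
  intros y Hy; apply NNPP; intro N.
  destruct (Hy _ (pdist_pos _ _ N)) as (z & -> & Hz); lra.
Qed.

Lemma closed_union P Q : closed P -> closed Q -> closed (union P Q).
Proof.
  intros HP HQ x Hx; apply NNPP; intro N.
  destruct (not_closed_ball P x HP) as (r & Hr & H1); [intro; apply N; now left|].
  destruct (not_closed_ball Q x HQ) as (r' & Hr' & H2); [intro; apply N; now right|].
  destruct (Hx (Rmin r r')) as (y & [Hy|Hy] & Hd); [now apply Rmin_pos| |].
  - apply (H1 y); auto; eapply Rlt_le_trans; [exact Hd|apply Rmin_l].
  - apply (H2 y); auto; eapply Rlt_le_trans; [exact Hd|apply Rmin_r].
Qed.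

Lemma closed_inter P Q : closed P -> closed Q -> closed (fun x => P x /\ Q x).
Proof.
  intros HP HQ x Hx; split; [apply HP|apply HQ];
    revert x Hx; apply closure_mono; intros x Hx; apply Hx.
Qed.

Lemma closed_ball x r : closed (fun y => pdist X x y <= r).
Proof.
  intros y Hy; apply Rnot_lt_le; intro N.
  destruct (Hy (pdist X x y - r)) as (z & Hz & Hd); [lra|].
  pose proof (pdist_tri X x z y); rewrite (pdist_sym X z y) in *; lra.
Qed.

Lemma closed_ball_compl x r : closed (fun y => r <= pdist X x y).
Proof.
  intros y Hy; apply Rnot_lt_le; intro N.
  destruct (Hy (r - pdist X x y)) as (z & Hz & Hd); [lra|].
  pose proof (pdist_tri X x y z); lra.
Qed.

Record derivation d : Prop := {
  der_mono : forall P Q, incl P Q -> incl (d P) (d Q);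
  der_closed : forall P, closed P -> closed (d P);
  der_incl : forall P, closed P -> incl (d P) P
}.

Definition additive d : Prop :=
  forall P Q, closed P -> closed Q -> incl (d (union P Q)) (union (d P) (d Q)).


Lemma iter_mono d a P Q : derivation d -> incl P Q -> incl (iter d a P) (iter d a Q).
Proof.
  intros Hd H; induction a as [|a IH|f IH]; simpl; auto.
  - now apply der_mono.
  - intros x Hx n; apply IH; auto.
Qed.

Lemma closed_iter d a P : derivation d -> closed P -> closed (iter d a P).
Proof.
  intros Hd H; induction a as [|a IH|f IH]; simpl; auto.
  - now apply der_closed.
  - intros x Hx n; apply IH; revert x Hx; apply closure_mono; intros x Hx; apply Hx.
Qed.

Lemma iter_incl d a P : derivation d -> closed P -> incl (iter d a P) P.
Proof.
  intros Hd H; induction a as [|a IH|f IH]; simpl.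
  - now intros x.
  - intros x Hx; apply IH; apply (der_incl d Hd); auto using closed_iter.
  - intros x Hx; apply (IH O); auto.
Qed.

Lemma derivation_iter d a : derivation d -> derivation (iter d a).
Proof. intro Hd; split; intros; auto using iter_mono, closed_iter, iter_incl. Qed.

Lemma iter_antitone d a b P : derivation d -> closed P -> ord_le a b ->
  incl (iter d b P) (iter d a P).
Proof.
  intros Hd HP; induction 1 as [|a b _ IH|a b _ IH|f b _ IH|a f n _ IH]; simpl.
  - now apply iter_incl.
  - now apply der_mono.
  - intros x Hx; apply IH, (der_incl d Hd); auto using closed_iter.
  - intros x Hx n; apply IH, Hx.
  - intros x Hx; apply IH, Hx.
Qed.

(** At a supremum, a point lost from the two iterates at stages [f n] and [f m] is lost from both at
    the larger of these stages. *)
Lemma additive_iter d a : derivation d -> additive d -> additive (iter d a).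
Proof.
  intros Hd Ha P Q HP HQ; induction a as [|a IH|f IH]; simpl; auto.
  - now intros x.
  - intros x Hx; apply Ha; auto using closed_iter.
    revert x Hx; now apply der_mono.
  - intros x Hx; apply NNPP; intro N.
    apply not_or_and in N; destruct N as [N1 N2].
    apply not_all_ex_not in N1, N2; destruct N1 as [n N1], N2 as [m N2].
    destruct (ord_le_total (f n) (f m)) as [L|L%ord_le_S_l].
    + destruct (IH m x (Hx m)) as [K|K]; auto.
      apply N1; revert K; now apply iter_antitone.
    + destruct (IH n x (Hx n)) as [K|K]; auto.
      apply N2; revert K; now apply iter_antitone.
Qed.

(** The one-step comparison is asked only for closed subsets of [Q], so that it can be applied
    inside a small ball. *)
Lemma iter_le (d e : (X -> Prop) -> X -> Prop) a Q : derivation d -> closed Q ->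
  (forall P Q, incl P Q -> incl (e P) (e Q)) ->
  (forall P, closed P -> incl P Q -> incl (d P) (e P)) ->
  incl (iter d a Q) (iter e a Q).
Proof.
  intros Hd HQ He H; induction a as [|a IH|f IH]; simpl.
  - now intros x.
  - intros x Hx; apply He with (1 := IH).
    apply H; auto using closed_iter, iter_incl.
  - intros x Hx n; apply IH; auto.
Qed.

(** Additivity distributes the n + m steps into words in [d] and [e]; each word contains n letters
    [d] or m letters [e], and the other letters only shrink the set. The induction peels off the
    first application, hence [shift]. *)
Lemma iter_fin_union c d e n m P :
  derivation c -> additive c -> derivation d -> derivation e ->
  (forall P, closed P -> incl (c P) (union (d P) (e P))) -> closed P ->
  incl (iter c (fin (n + m)) P) (union (iter d (fin n) P) (iter e (fin m) P)).
Proof.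
  intros Hc Ha Hd He H.
  assert (shift : forall d k P, derivation d ->
            forall x, iter d (fin (S k)) P x <-> iter d (fin k) (d P) x).
  { intros d' k P' Hd'; induction k as [|k IH]; intro x; [reflexivity|].
    split; apply (der_mono d' Hd'); intro y; apply IH. }
  remember (n + m)%nat as k eqn:E; revert n m E P.
  induction k as [|k IH]; intros n m E P HP x Hx.
  - destruct n; [left; exact Hx|lia].
  - destruct n as [|n]; [left; exact (iter_incl c _ P Hc HP x Hx)|].
    destruct m as [|m]; [right; exact (iter_incl c _ P Hc HP x Hx)|].
    apply shift in Hx; auto.
    apply (iter_mono c _ _ _ Hc (H P HP)) in Hx.
    apply additive_iter in Hx; auto using der_closed.
    destruct Hx as [Hx|Hx].
    + destruct (IH n (S m) ltac:(lia) (d P) (der_closed d Hd P HP) x Hx) as [K|K].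
      * left; now apply shift.
      * right; revert K; apply iter_mono; auto using der_incl.
    + destruct (IH (S n) m ltac:(lia) (e P) (der_closed e He P HP) x Hx) as [K|K].
      * left; revert K; apply iter_mono; auto using der_incl.
      * right; now apply shift.
Qed.

(** Powers of omega are the lengths for which nothing is lost: at a successor the finite lemma is
    applied to the omega^k-th iterates, and n + m is still below omega. *)
Lemma iter_oexp_union c d e k P :
  derivation c -> additive c -> derivation d -> derivation e ->
  (forall P, closed P -> incl (c P) (union (d P) (e P))) -> closed P ->
  incl (iter c (oexp k) P) (union (iter d (oexp k) P) (iter e (oexp k) P)).
Proof.
  intros Hc Ha Hd He H; revert P; induction k as [|k IH|f IH]; intros P HP.
  - exact (H P HP).
  - intros x Hx; apply NNPP; intro N.
    apply not_or_and in N; destruct N as [N1 N2]; cbn [oexp omul omega iter] in N1, N2.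
    apply not_all_ex_not in N1, N2; destruct N1 as [n N1], N2 as [m N2].
    specialize (Hx (n + m)%nat); apply iter_omul in Hx; [|apply Hc].
    rewrite iter_omul in N1 by apply Hd; rewrite iter_omul in N2 by apply He.
    destruct (iter_fin_union (iter c (oexp k)) (iter d (oexp k)) (iter e (oexp k)) n m P)
      with (x := x); auto using derivation_iter, additive_iter.
  - intros x Hx; apply NNPP; intro N.
    apply not_or_and in N; destruct N as [N1 N2]; cbn [oexp iter] in N1, N2.
    apply not_all_ex_not in N1, N2; destruct N1 as [n N1], N2 as [m N2].
    destruct (ord_le_total (f n) (f m)) as [L%oexp_le|L%ord_le_S_l%oexp_le].
    + destruct (IH m P HP x (Hx m)) as [K|K]; auto.
      apply N1; revert K; now apply iter_antitone.
    + destruct (IH n P HP x (Hx n)) as [K|K]; auto.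
      apply N2; revert K; now apply iter_antitone.
Qed.

(* [delta X h eps] is, up to conversion, the instance [R x y := eps <= |h y - h x|], and
   [hM h M] agrees on closed sets with the instance [R x y := y <> x /\ M < |h y|]. *)
Definition rder (R : X -> X -> Prop) P : X -> Prop :=
  closure X (fun x => P x /\ forall r, 0 < r -> exists y, P y /\ pdist X x y < r /\ R x y).

Lemma derivation_rder R : derivation (rder R).
Proof.
  split.
  - intros P Q H; apply closure_mono; intros x [Hx K]; split; auto.
    intros r Hr; destruct (K r Hr) as (y & Hy & Hd & HR); exists y; auto.
  - intros P _; apply closed_closure.
  - intros P HP x Hx; apply HP; revert x Hx; apply closure_mono; now intros x [Hx _].
Qed.

(** The right side is closed, so only points before closure matter; a ball free of [R1]-partners and
    one free of [R2]-partners would have an intersection free of [R]-partners. *)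
Lemma rder_union_rel R R1 R2 P :
  (forall x y, P x -> P y -> R x y -> R1 x y \/ R2 x y) ->
  incl (rder R P) (union (rder R1 P) (rder R2 P)).
Proof.
  intros H x Hx.
  apply (closed_union (rder R1 P) (rder R2 P) (closed_closure _) (closed_closure _)).
  revert x Hx; apply closure_mono; intros x [Hx K].
  apply NNPP; intro N; apply not_or_and in N; destruct N as [N1 N2].
  assert (M1 : exists r, 0 < r /\ forall y, P y -> pdist X x y < r -> ~ R1 x y).
  { apply NNPP; intro N; apply N1, closure_incl; split; auto; intros r Hr.
    apply NNPP; intro N'; apply N; exists r; split; auto; intros y Hy Hd HR; eauto 6. }
  assert (M2 : exists r, 0 < r /\ forall y, P y -> pdist X x y < r -> ~ R2 x y).
  { apply NNPP; intro N; apply N2, closure_incl; split; auto; intros r Hr.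
    apply NNPP; intro N'; apply N; exists r; split; auto; intros y Hy Hd HR; eauto 6. }
  destruct M1 as (r1 & Hr1 & M1), M2 as (r2 & Hr2 & M2).
  destruct (K (Rmin r1 r2)) as (y & Hy & Hd & HR); [now apply Rmin_pos|].
  destruct (H x y Hx Hy HR) as [E|E].
  - apply (M1 y); auto; eapply Rlt_le_trans; [exact Hd|apply Rmin_l].
  - apply (M2 y); auto; eapply Rlt_le_trans; [exact Hd|apply Rmin_r].
Qed.

Lemma rder_mono_rel R R' P :
  (forall x y, P x -> P y -> R x y -> R' x y) -> incl (rder R P) (rder R' P).
Proof.
  intro H; apply closure_mono; intros x [Hx K]; split; auto.
  intros r Hr; destruct (K r Hr) as (y & Hy & Hd & HR); exists y; auto.
Qed.

(* Witnesses from [Q] accumulating at a point force that point into the closed set [Q]. *)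
Lemma additive_rder R : additive (rder R).
Proof.
  intros P Q HP HQ x Hx.
  destruct (rder_union_rel R (fun x y => P y /\ R x y) (fun x y => Q y /\ R x y) (union P Q))
    with (x := x) as [K|K]; auto.
  - intros a b _ [Hb|Hb]; auto.
  - left; revert x Hx K; intros x _; apply closure_mono; intros y [Hy K]; split.
    + apply HP; intros r Hr; destruct (K r Hr) as (z & _ & Hz & Hz' & _); eauto.
    + intros r Hr; destruct (K r Hr) as (z & _ & Hz & Hz' & HR); eauto.
  - right; revert x Hx K; intros x _; apply closure_mono; intros y [Hy K]; split.
    + apply HQ; intros r Hr; destruct (K r Hr) as (z & _ & Hz & Hz' & _); eauto.
    + intros r Hr; destruct (K r Hr) as (z & _ & Hz & Hz' & HR); eauto.
Qed.

Lemma derivation_delta h eps : derivation (delta X h eps).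
Proof. exact (derivation_rder (fun x y => eps <= Rabs (h y - h x))). Qed.

Lemma accum_mono P Q : incl P Q -> incl (accum X P) (accum X Q).
Proof.
  intros H x Hx r Hr; destruct (Hx r Hr) as (y & Hy & Hd); exists y; auto.
Qed.

Lemma accum_incl P : closed P -> incl (accum X P) P.
Proof. intros HP x Hx; apply HP; intros r Hr; destruct (Hx r Hr) as (y & Hy & _ & Hd); eauto. Qed.

Lemma derivation_hM h M : derivation (hM X h M).
Proof.
  split.
  - intros P Q H; apply accum_mono; intros x [Hx K]; auto.
  - intros P _; apply closed_accum.
  - intros P HP x Hx; apply accum_incl; auto; revert x Hx; apply accum_mono; now intros x [Hx _].
Qed.

Lemma derivation_Omega h s : derivation (Omega X h s).
Proof.
  split.
  - intros P Q H x Hx n; specialize (Hx n); revert x Hx; apply accum_mono.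
    intros y (eta & He & Hy); exists eta; split; auto.
    revert y Hy; apply iter_mono; auto using derivation_delta.
  - intros P _ x Hx n; apply closed_accum; revert x Hx; apply closure_mono; intros x Hx; apply Hx.
  - intros P HP x Hx; apply accum_incl; auto; specialize (Hx O); revert x Hx; apply accum_mono.
    intros y (eta & _ & Hy); revert Hy; apply iter_incl; auto using derivation_delta.
Qed.

(** Split [P] into its parts inside and outside the ball; the derivative of the outer part stays in
    that part, which misses [x]. *)
Lemma localize d P x r : additive d -> derivation d -> closed P -> 0 < r -> d P x ->
  d (fun y => P y /\ pdist X x y <= r) x.
Proof.
  intros Ha Hd HP Hr Hx.
  assert (H : union (d (fun y => P y /\ pdist X x y <= r))
                    (d (fun y => P y /\ r <= pdist X x y)) x).
  { apply Ha; auto using closed_inter, closed_ball, closed_ball_compl.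
    revert x Hx; intros x; apply der_mono; auto.
    intros y Hy; destruct (Rle_or_lt (pdist X x y) r); [left|right]; split; auto; lra. }
  destruct H as [H|H]; auto.
  apply (der_incl d Hd) in H; auto using closed_inter, closed_ball_compl.
  destruct H as [_ H]; rewrite pdist_refl in H; lra.
Qed.

(** * Sufficiency *)

Section Sufficiency.
Variables (h f : X -> R) (xi : ord) (s : nat -> ord).
Hypothesis Hs_inc : forall n, ord_lt (s n) (s (S n)).
Hypothesis Hs_lim : ord_eq (OL s) (oexp (oexp xi)).
Variable eps : R.
Hypothesis Heps : 0 < eps.

Let G := rder (fun x y => eps <= Rabs (f x) * Rabs (h y - h x)).
Let F := delta X f 1.
Let L := oexp (oexp xi).

(** Off [F P] the function f varies by less than 1 near [x], so |f| <= K = |f x| + 1 there and every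
    [G]-pair is a pair for [delta] with eta = eps / K. Additivity confines the whole iteration to
    that neighbourhood. *)
Lemma weighted_osc_iter a P x : closed P -> iter G a P x -> ~ F P x ->
  exists eta, 0 < eta /\ iter (delta X h eta) a P x.
Proof.
  intros HP Hx HF.
  assert (HG : derivation (iter G a)) by apply derivation_iter, derivation_rder.
  assert (HPx : P x) by (apply (der_incl _ HG) in Hx; auto).
  assert (Hr : exists r, 0 < r /\ forall y, P y -> pdist X x y < r -> Rabs (f y - f x) < 1).
  { apply NNPP; intro N; apply HF, closure_incl; split; auto; intros r Hr.
    apply NNPP; intro N'; apply N; exists r; split; auto; intros y Hy Hd.
    apply Rnot_le_lt; intro; apply N'; eauto. }
  destruct Hr as (r & Hr & Hb).
  set (K := Rabs (f x) + 1).
  assert (HK : 0 < K) by (unfold K; pose proof (Rabs_pos (f x)); lra).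
  exists (eps / K); split; [now apply Rdiv_lt_0_compat|].
  apply localize with (r := r / 2) in Hx; auto; [|apply additive_iter|lra].
  2: apply derivation_rder. 2: apply additive_rder.
  assert (Hc : closed (fun y => P y /\ pdist X x y <= r / 2))
    by auto using closed_inter, closed_ball.
  apply iter_mono with (P := fun y => P y /\ pdist X x y <= r / 2);
    [apply derivation_delta|now intros y []|].
  revert Hx; apply iter_le; [apply derivation_rder|auto| |].
  - apply (der_mono _ (derivation_delta h (eps / K))).
  - intros P' _ HP'.
    apply (rder_mono_rel _ (fun x y => eps / K <= Rabs (h y - h x))).
    intros u v Hu _ Huv.
    destruct (HP' _ Hu) as [Hu1 Hu2].
    assert (Hfu : Rabs (f u) <= K).
    { unfold K; specialize (Hb u Hu1 ltac:(lra)).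
      replace (f u) with (f x + (f u - f x)) by ring.
      pose proof (Rabs_triang (f x) (f u - f x)); lra. }
    apply Rmult_le_reg_l with K; auto.
    replace (K * (eps / K)) with eps by (field; lra).
    eapply Rle_trans; [exact Huv|].
    apply Rmult_le_compat_r; [apply Rabs_pos|auto].
Qed.

(** If [x] escapes both sets, then in a small ball the iterate [J] of [G] of length s (n+1) is
    bounded by [F] apart from the point [x]. After s m such blocks [F] has left the ball, only [x]
    remains, and one more block removes it. The total length s (n+1) (s m + 1) is at most [L] by
    multiplicative indecomposability. *)
Lemma weighted_osc_Omega P : closed P ->
  incl (iter G L P) (union (Omega X h s P) (iter F L P)).
Proof.
  intros HP x Hx; apply NNPP; intro N; apply not_or_and in N; destruct N as [NO NF].
  assert (HG : derivation G) by apply derivation_rder.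
  assert (HaG : additive G) by apply additive_rder.
  assert (HF : derivation F) by apply derivation_delta.
  assert (Hinc : forall n, ord_le (s n) L)
    by (intro n; eapply ord_le_trans; [apply ord_le_L|apply Hs_lim]).
  apply not_all_ex_not in NO; destruct NO as [n NO].
  (* Passing from s n to s (n+1) makes the block length nonzero, which [Jx] needs: s 0 may be
     zero. *)
  assert (Hr : exists r, 0 < r /\ forall y eta, 0 < eta -> pdist X x y < r ->
                 iter (delta X h eta) (s (S n)) P y -> y = x).
  { apply NNPP; intro N; apply NO; intros r Hr; apply NNPP; intro N'; apply N.
    exists r; split; auto; intros y eta He Hd Hy; apply NNPP; intro Hne; apply N'.
    exists y; split; auto; exists eta; split; auto.
    revert Hy; apply iter_antitone; auto using derivation_delta.
    apply ord_le_S_l, Hs_inc. }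
  destruct Hr as (r & Hr & HO).
  assert (Hm : exists m, ~ iter F (s m) P x).
  { apply not_all_ex_not; intro K; apply NF.
    apply (iter_antitone F _ (OL s) P HF HP); [apply Hs_lim|exact K]. }
  destruct Hm as [m Hm].
  destruct (not_closed_ball _ x (closed_iter F (s m) P HF HP) Hm) as (r' & Hr' & HF').
  (* Half the minimum puts the closed ball [Q] inside both open balls. *)
  set (rho := Rmin r r' / 2).
  assert (Hrho : 0 < rho /\ rho < r /\ rho < r').
  { unfold rho; pose proof (Rmin_pos _ _ Hr Hr'); pose proof (Rmin_l r r');
      pose proof (Rmin_r r r'); lra. }
  set (Q := fun y => P y /\ pdist X x y <= rho).
  assert (HQ : closed Q) by (unfold Q; auto using closed_inter, closed_ball).
  assert (HQP : incl Q P) by (now intros y []).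
  set (J := iter G (s (S n))).
  assert (HJ : derivation J) by now apply derivation_iter.
  assert (HaJ : additive J) by now apply additive_iter.
  assert (J1 : forall Q', closed Q' -> incl Q' Q ->
                 incl (J Q') (union (F Q') (fun y => y = x))).
  { intros Q' HQ' Hincl y Hy; destruct (classic (F Q' y)) as [|N]; [now left|right].
    destruct (weighted_osc_iter _ _ _ HQ' Hy N) as (eta & He & Hy').
    apply HO with eta; auto.
    - assert (HQy : Q y) by (apply Hincl; apply (der_incl J HJ) in Hy; auto).
      destruct HQy; lra.
    - revert Hy'; apply iter_mono; auto using derivation_delta.
      intros z Hz; auto. }
  assert (Jx : forall y, ~ J (fun z => z = x) y).
  { intros y Hy.
    apply (iter_antitone G (OS OZ) (s (S n))) in Hy; auto using closed_single.
    - destruct (Hy 1 Rlt_0_1) as (z & [-> K] & _).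
      destruct (K 1 Rlt_0_1) as (z & -> & _ & E).
      rewrite Rminus_diag, Rabs_R0, Rmult_0_r in E; lra.
    - eapply ord_le_trans; [apply ole_SS, ole_Z|apply Hs_inc]. }
  assert (J2 : forall b, incl (iter J b Q) (union (iter F b Q) (fun y => y = x))).
  { induction b as [|b IH|g IH]; simpl.
    - intros y Hy; now left.
    - intros y Hy; apply (der_mono J HJ _ _ IH) in Hy.
      apply HaJ in Hy; auto using closed_iter, closed_single.
      destruct Hy as [Hy|Hy]; [|exfalso; eapply Jx; eauto].
      apply J1 in Hy; auto using closed_iter, iter_incl.
    - intros y Hy; destruct (classic (y = x)) as [|N]; [now right|left].
      intro k; destruct (IH k y (Hy k)); [auto|contradiction]. }
  apply localize with (r := rho) in Hx; auto using derivation_iter, additive_iter; [|apply Hrho].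
  change (iter G L Q x) in Hx.
  assert (Hlt : ord_lt (s (S n)) L)
    by (eapply ord_le_trans; [apply Hs_inc|apply Hinc]).
  assert (Hle : ord_le (omul (s (S n)) (OS (s m))) L).
  { eapply ord_le_trans; [|apply oexp_oexp_mul_absorb, Hlt].
    apply omul_le_r; eapply ord_le_trans; [apply Hs_inc|apply Hinc]. }
  apply (iter_antitone G _ _ Q HG HQ Hle) in Hx.
  apply iter_omul in Hx; [|apply HG].
  apply (Jx x); revert Hx; apply (der_mono J HJ).
  intros y Hy; destruct (J2 _ y Hy) as [K|K]; auto.
  exfalso; apply (HF' y).
  - destruct (iter_incl F _ Q HF HQ y K); lra.
  - revert K; now apply iter_mono.
Qed.

(** There are omega^alpha blocks of length [L], each bounded by one step of [Omega] or one block of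
    [F]; the union lemma for iterates separates the two kinds. *)
Lemma weighted_osc_empty alpha :
  (forall x, ~ iter (Omega X h s) (oexp alpha) (fullset X) x) ->
  (forall x, ~ iter F (omul L (oexp alpha)) (fullset X) x) ->
  forall x, ~ iter G (omul L (oexp alpha)) (fullset X) x.
Proof.
  intros HO HFe x Hx.
  assert (HG : derivation G) by apply derivation_rder.
  assert (HF : derivation F) by apply derivation_delta.
  apply iter_omul in Hx; [|apply HG].
  apply (iter_oexp_union (iter G L) (Omega X h s) (iter F L)) in Hx;
    auto using derivation_iter, derivation_Omega, closed_full, weighted_osc_Omega.
  - destruct Hx as [Hx|Hx]; [eapply HO; eauto|].
    apply (HFe x); apply iter_omul; [apply HF|auto].
  - apply additive_iter; [auto|apply additive_rder].
Qed.
End Sufficiency.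

Lemma mul_delta_empty h f xi alpha kappa s :
  (forall n, ord_lt (s n) (s (S n))) ->
  ord_eq (OL s) (oexp (oexp xi)) ->
  ord_eq kappa (oadd (oexp xi) alpha) ->
  (forall x, ~ (forall M, 0 < M -> iter (hM X h M) (oexp kappa) (fullset X) x)) ->
  (forall x, ~ iter (Omega X h s) (oexp alpha) (fullset X) x) ->
  (forall eps x, 0 < eps -> ~ iter (delta X f eps) (oexp kappa) (fullset X) x) ->
  forall eps x, 0 < eps -> ~ iter (delta X (fun x => h x * f x) eps) (oexp kappa) (fullset X) x.
Proof.
  intros Hinc Hlim Hk HM HO Hf eps x Heps Hx.
  assert (Hkl : ord_eq (oexp kappa) (omul (oexp (oexp xi)) (oexp alpha))).
  { destruct (oexp_oadd (oexp xi) alpha) as [E1 E2], Hk as [K1 K2]; split.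
    - eapply ord_le_trans; [apply oexp_le, K1|exact E1].
    - eapply ord_le_trans; [exact E2|apply oexp_le, K2]. }
  destruct (not_all_ex_not _ _ (HM x)) as [M NM]; apply imply_to_and in NM.
  destruct NM as [HM0 NM].
  (* Pairs with |h y| > M go to [R1]. For the others, h y (f y - f x) or f x (h y - h x) has size at
     least eps / 2, and dividing the first by M gives the threshold in [R2]. *)
  set (R1 := fun x y : X => y <> x /\ M < Rabs (h y)).
  set (R2 := fun x y : X => eps / 2 / M <= Rabs (f y - f x)).
  set (R3 := fun x y : X => eps / 2 <= Rabs (f x) * Rabs (h y - h x)).
  set (R23 := fun x y => R2 x y \/ R3 x y).
  apply (iter_oexp_union _ (rder R1) (rder R23)) in Hx;
    try apply derivation_delta; try apply derivation_rder; auto using closed_full.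
  2: exact (additive_rder (fun x y => eps <= Rabs (h y * f y - h x * f x))).
  2: { intros P _.
    apply (rder_union_rel (fun x y => eps <= Rabs (h y * f y - h x * f x))).
    intros a b _ _ E.
    (* Accumulation points ask for a partner different from the point itself. *)
    assert (Hne : b <> a) by (intros ->; rewrite Rminus_diag, Rabs_R0 in E; lra).
    destruct (Rlt_or_le M (Rabs (h b))) as [|Hb]; [left; split; auto|right].
    destruct (Rle_or_lt (eps / 2) (Rabs (f a) * Rabs (h b - h a))) as [|E3]; [now right|left].
    unfold R2; apply Rmult_le_reg_l with M; auto.
    replace (M * (eps / 2 / M)) with (eps / 2) by (field; lra).
    apply Rle_trans with (Rabs (h b) * Rabs (f b - f a)).
    2: apply Rmult_le_compat_r; auto using Rabs_pos.
    rewrite <- Rabs_mult in *.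
    replace (h b * f b - h a * f a) with (h b * (f b - f a) + f a * (h b - h a)) in E by ring.
    pose proof (Rabs_triang (h b * (f b - f a)) (f a * (h b - h a))); lra. }
  destruct Hx as [Hx|Hx].
  - apply NM; revert Hx; apply iter_le; auto using derivation_rder, closed_full.
    + apply (der_mono _ (derivation_hM h M)).
    + intros P HP _ y Hy; apply closed_accum; revert y Hy; apply closure_mono.
      intros y [Hy K] r Hr; destruct (K r Hr) as (z & Hz & Hd & Hne & Hb); exists z; auto.
  - apply (iter_oexp_union _ (rder R2) (rder R3)) in Hx;
      auto using derivation_rder, additive_rder, closed_full.
    2: { intros P _; apply rder_union_rel; auto. }
    destruct Hx as [Hx|Hx].
    + apply (Hf (eps / 2 / M) x); auto.
      repeat apply Rdiv_lt_0_compat; lra.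
    + apply (weighted_osc_empty h f xi s Hinc Hlim (eps / 2) ltac:(lra) alpha HO) with x.
      * intros y Hy; apply (Hf 1 y Rlt_0_1); revert Hy.
        apply iter_antitone; auto using derivation_delta, closed_full; apply Hkl.
      * revert Hx; apply iter_antitone; auto using derivation_rder, closed_full; apply Hkl.
Qed.
End Derivations.

(** * Baire one functions from gauges *)

Lemma Rabs_le_bounds a b : Rabs a <= b -> - b <= a <= b.
Proof. unfold Rabs; destruct Rcase_abs; lra. Qed.

Definition clamp (c v : R) : R := Rmax (- c) (Rmin c v).

Lemma clamp_bound c v : 0 <= c -> Rabs (clamp c v) <= c.
Proof.
  intro Hc; unfold clamp, Rmax, Rmin; repeat destruct Rle_dec; apply Rabs_le; lra.
Qed.

Lemma clamp_id c v : Rabs v <= c -> clamp c v = v.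
Proof.
  intro H; apply Rabs_le_bounds in H; unfold clamp, Rmax, Rmin; repeat destruct Rle_dec; lra.
Qed.

Lemma clamp_lip c v w : Rabs (clamp c v - clamp c w) <= Rabs (v - w).
Proof.
  unfold clamp, Rmax, Rmin, Rabs; repeat destruct Rle_dec; repeat destruct Rcase_abs; lra.
Qed.

Section Gauge.
Variable X : PolishSpace.

Lemma continuous_plus (u v : X -> R) : continuous X u -> continuous X v ->
  continuous X (fun x => u x + v x).
Proof.
  intros Hu Hv x e He.
  destruct (Hu x (e / 2)) as (a & Ha & Ka); [lra|].
  destruct (Hv x (e / 2)) as (b & Hb & Kb); [lra|].
  exists (Rmin a b); split; [now apply Rmin_pos|intros y Hy].
  specialize (Ka y ltac:(eapply Rlt_le_trans; [exact Hy|apply Rmin_l])).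
  specialize (Kb y ltac:(eapply Rlt_le_trans; [exact Hy|apply Rmin_r])).
  replace (u x + v x - (u y + v y)) with ((u x - u y) + (v x - v y)) by ring.
  eapply Rle_lt_trans; [apply Rabs_triang|lra].
Qed.

Lemma continuous_clamp_sub c (u v : X -> R) : continuous X u -> continuous X v ->
  continuous X (fun x => clamp c (u x - v x)).
Proof.
  intros Hu Hv x e He.
  destruct (Hu x (e / 2)) as (a & Ha & Ka); [lra|].
  destruct (Hv x (e / 2)) as (b & Hb & Kb); [lra|].
  exists (Rmin a b); split; [now apply Rmin_pos|intros y Hy].
  specialize (Ka y ltac:(eapply Rlt_le_trans; [exact Hy|apply Rmin_l])).
  specialize (Kb y ltac:(eapply Rlt_le_trans; [exact Hy|apply Rmin_r])).
  eapply Rle_lt_trans; [apply clamp_lip|].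
  replace (u x - v x - (u y - v y)) with ((u x - u y) - (v x - v y)) by ring.
  unfold Rminus at 1; eapply Rle_lt_trans; [apply Rabs_triang|rewrite Rabs_Ropp; lra].
Qed.

(* The approximant is the Lipschitz sup-convolution [u x = sup_(p in A) (f p - L d(x,p))]. *)
Lemma lipschitz_approx (A : X -> Prop) (f : X -> R) K t e :
  0 <= K -> 0 < t -> 0 <= e ->
  (forall x, A x -> Rabs (f x) <= K) ->
  (forall x y, A x -> A y -> pdist X x y < t -> Rabs (f x - f y) <= e) ->
  exists u, continuous X u /\ forall x, A x -> Rabs (u x - f x) <= e.
Proof.
  intros HK Ht He Hb Hc.
  destruct (classic (exists p, A p)) as [[p0 Hp0]|N].
  2: { exists (fun _ => 0); split.
    - intros x r Hr; exists 1; split; [lra|intros; rewrite Rminus_diag, Rabs_R0; auto].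
    - intros x Hx; exfalso; eauto. }
  set (L := (2 * K + 1) / t).
  assert (HL : 0 < L) by (unfold L; apply Rdiv_lt_0_compat; lra).
  assert (HLt : L * t = 2 * K + 1) by (unfold L; field; lra).
  assert (Hu : forall x, exists m, is_lub (fun v => exists p, A p /\ v = f p - L * pdist X x p) m).
  { intro x; destruct (completeness (fun v => exists p, A p /\ v = f p - L * pdist X x p)) as [m Hm].
    - exists K; intros v (p & Hp & ->).
      pose proof (Hb p Hp) as B; apply Rabs_le_bounds in B.
      pose proof (Rmult_le_pos L _ (Rlt_le _ _ HL) (pdist_nonneg X x p)); lra.
    - exists (f p0 - L * pdist X x p0); eauto.
    - eauto. }
  destruct (choice _ Hu) as [u Lu]; clear Hu.
  assert (Hlip : forall x y, u x <= u y + L * pdist X x y).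
  { intros x y; apply (Lu x); intros v (p & Hp & ->).
    assert (H : f p - L * pdist X y p <= u y) by (apply (Lu y); eauto).
    pose proof (pdist_tri X y x p); rewrite (pdist_sym X y x) in *.
    assert (L * pdist X y p <= L * (pdist X x y + pdist X x p)) by (apply Rmult_le_compat_l; lra).
    lra. }
  exists u; split.
  - intros x r Hr; exists (r / L); split; [now apply Rdiv_lt_0_compat|intros y Hy].
    pose proof (Hlip x y); pose proof (Hlip y x) as H'; rewrite (pdist_sym X y x) in H'.
    assert (L * pdist X x y < r).
    { replace r with (L * (r / L)) by (field; lra); now apply Rmult_lt_compat_l. }
    apply Rabs_def1; lra.
  - intros x Hx; apply Rabs_le; split.
    + assert (f x - L * pdist X x x <= u x) by (apply (Lu x); eauto).
      rewrite pdist_refl in *; lra.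
    + enough (u x <= f x + e) by lra.
      apply (Lu x); intros v (p & Hp & ->).
      destruct (Rlt_or_le (pdist X x p) t) as [H|H].
      * pose proof (Hc x p Hx Hp H) as B; apply Rabs_le_bounds in B.
        pose proof (Rmult_le_pos L _ (Rlt_le _ _ HL) (pdist_nonneg X x p)); lra.
      * assert (L * t <= L * pdist X x p) by (apply Rmult_le_compat_l; lra).
        pose proof (Hb x Hx) as B; apply Rabs_le_bounds in B.
        pose proof (Hb p Hp) as B'; apply Rabs_le_bounds in B'; lra.
Qed.

(** The epsilon-delta form of the Baire one property: the radius depends on the point with no
    regularity, and both radii must exceed the distance. *)
Definition gauge (f : X -> R) (e : R) (g : X -> R) : Prop :=
  (forall x, 0 < g x) /\
  forall x y, pdist X x y < g x -> pdist X x y < g y -> Rabs (f x - f y) < e.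

(* The sets [A n k] increase to [X] with [k] and decrease with [n].  If [u n] approximates [f] up
   to [2^-n] on [A n k], then in [u 0 + sum_(n < k) clamp (2 * 2^-n) (u (n+1) - u n)] the clamps
   with [n < m] are inactive on [A m k], and the remaining ones sum to at most [4 * 2^-m]. *)
Lemma Baire1_of_gauges (f : X -> R) :
  (forall e, 0 < e -> exists g, gauge f e g) -> Baire1 X f.
Proof.
  intro H.
  set (e := fun n => (/ 2) ^ n).
  assert (He : forall n, 0 < e n) by (intro n; apply pow_lt; lra).
  assert (HeS : forall n, e (S n) = e n / 2) by (intro n; unfold e; simpl; lra).
  destruct (choice (fun n g => gauge f (e n) g) (fun n => H _ (He n))) as [g Hg].
  set (A := fun n k x => (forall i, (i <= n)%nat -> / INR (S k) < g i x) /\ Rabs (f x) <= INR k).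
  assert (Hu : forall nk : nat * nat, exists u, continuous X u /\
             forall x, A (fst nk) (snd nk) x -> Rabs (u x - f x) <= e (fst nk)).
  { intros [n k]; cbn [fst snd].
    apply lipschitz_approx with (K := INR k) (t := / INR (S k)).
    - apply pos_INR.
    - apply Rinv_0_lt_compat, lt_0_INR; lia.
    - apply Rlt_le, He.
    - now intros x [_ Hx].
    - intros x y [Hx _] [Hy _] Hd; apply Rlt_le, (proj2 (Hg n));
        (eapply Rlt_trans; [exact Hd|]); auto. }
  destruct (choice _ Hu) as [u' Hu']; clear Hu.
  set (u := fun n k => u' (n, k)).
  set (G := fun k => fix G (n : nat) (x : X) : R := match n with
     | O => u O k x
     | S n => G n x + clamp (2 * e n) (u (S n) k x - u n k x) end).
  assert (GS : forall k n x, G k (S n) x = G k n x + clamp (2 * e n) (u (S n) k x - u n k x))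
    by reflexivity.
  assert (GA : forall k m x, A m k x -> forall n, (n <= m)%nat -> G k n x = u n k x).
  { intros k m x [HA1 HA2]; induction n as [|n IH]; intro Hn; [reflexivity|].
    rewrite GS, IH by lia; rewrite clamp_id; [ring|].
    assert (B1 : Rabs (u n k x - f x) <= e n)
      by (apply (Hu' (n, k)); split; auto; intros; apply HA1; cbn in *; lia).
    assert (B2 : Rabs (u (S n) k x - f x) <= e (S n))
      by (apply (Hu' (S n, k)); split; auto; intros; apply HA1; cbn in *; lia).
    apply Rabs_le_bounds in B1, B2; rewrite HeS in B2; pose proof (He n); apply Rabs_le; lra. }
  (* The right side equals e m at n = m and grows by exactly the clamp bound 2 e n at each step,
     since e (n+1) = e n / 2. *)
  assert (GB : forall k m x n, A m k x -> (m <= n)%nat ->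
             Rabs (G k n x - f x) <= 5 * e m - 4 * e n).
  { intros k m x n HA Hn; induction Hn as [|n Hn IH].
    - rewrite (GA _ _ _ HA) by lia.
      eapply Rle_trans; [apply (Hu' (m, k)); exact HA|cbn [fst]; lra].
    - rewrite GS, HeS.
      pose proof (clamp_bound (2 * e n) (u (S n) k x - u n k x)
                    ltac:(pose proof (He n); lra)) as B.
      apply Rabs_le_bounds in IH, B; apply Rabs_le; lra. }
  exists (fun k => G k k); split.
  - intro k; generalize k at 2; induction k0 as [|n IH].
    + apply (Hu' (O, k)).
    + apply (continuous_plus (G k n) (fun x => clamp (2 * e n) (u (S n) k x - u n k x))); auto.
      apply continuous_clamp_sub; [apply (Hu' (S n, k))|apply (Hu' (n, k))].
  - intros x r Hr.
    assert (Hm : exists m, 5 * e m < r).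
    { destruct (pow_lt_1_zero (/ 2)) with (y := r / 5) as [m Hm];
        [rewrite Rabs_pos_eq; lra|lra|].
      exists m; specialize (Hm m (Nat.le_refl m)).
      rewrite Rabs_pos_eq in Hm by (apply Rlt_le, He); unfold e; lra. }
    destruct Hm as [m Hm].
    assert (Hk : exists k0, forall k, (k0 <= k)%nat -> forall i, (i <= m)%nat -> / INR (S k) < g i x).
    { clear Hm; induction m as [|m [k0 IH]].
      - destruct (archimed_cor1 (g O x)) as (N & HN & HN0); [apply (Hg O)|].
        exists N; intros k Hk i Hi; replace i with O by lia.
        eapply Rlt_trans; [|exact HN]; apply Rinv_lt_contravar.
        + apply Rmult_lt_0_compat; apply lt_0_INR; lia.
        + apply lt_INR; lia.
      - destruct (archimed_cor1 (g (S m) x)) as (N & HN & HN0); [apply (Hg (S m))|].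
        exists (Nat.max k0 N); intros k Hk i Hi.
        destruct (Nat.eq_dec i (S m)) as [->|Ne]; [|apply IH; lia].
        eapply Rlt_trans; [|exact HN]; apply Rinv_lt_contravar.
        + apply Rmult_lt_0_compat; apply lt_0_INR; lia.
        + apply lt_INR; lia. }
    destruct Hk as [k0 Hk0].
    destruct (INR_unbounded (Rabs (f x))) as [k1 Hk1].
    exists (Nat.max m (Nat.max k0 k1)); intros k Hk.
    eapply Rle_lt_trans; [apply (GB k m)|].
    + split; [intros; apply Hk0; lia|].
      apply Rlt_le, Rlt_le_trans with (INR k1); auto; apply le_INR; lia.
    + lia.
    + pose proof (He k); lra.
Qed.

(** A point cannot leave for the first time at a supremum, so it leaves between some stage and its
    successor. *)
Lemma iter_level d a (x : X) : ~ iter d a (fullset X) x ->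
  exists b, iter d b (fullset X) x /\ ~ iter d (OS b) (fullset X) x.
Proof.
  induction a as [|a IH|f IH]; intro H.
  - exfalso; apply H; exact I.
  - destruct (classic (iter d a (fullset X) x)); eauto.
  - apply not_all_ex_not in H; destruct H as [n H]; eauto.
Qed.

(** Let x leave after stage b. Its radius is chosen so that the ball misses stage b + 1 and f stays
    within e of f x on stage b. For two points in each other's balls, the one of later level lies in
    the stage of the other, where the estimate holds. *)
Lemma gauge_of_rank (f : X -> R) e a :
  (forall x, ~ iter (delta X f e) a (fullset X) x) -> exists g, gauge f e g.
Proof.
  intro H; set (d := delta X f e) in *.
  assert (Hd : derivation X d) by apply derivation_delta.
  assert (Hp : forall x, exists p : ord * R, iter d (fst p) (fullset X) x /\ 0 < snd p /\
     forall y, pdist X x y < snd p -> ~ iter d (OS (fst p)) (fullset X) y /\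
       (iter d (fst p) (fullset X) y -> Rabs (f y - f x) < e)).
  { intro x; destruct (iter_level d a x (H x)) as (b & Hb & Nb).
    destruct (not_closed_ball X _ x (closed_iter X d (OS b) _ Hd (closed_full X)) Nb)
      as (r & Hr & K).
    assert (K' : exists r', 0 < r' /\ forall y, pdist X x y < r' ->
                   iter d b (fullset X) y -> Rabs (f y - f x) < e).
    { apply NNPP; intro N; apply Nb, closure_incl; split; auto; intros r' Hr'.
      apply NNPP; intro N'; apply N; exists r'; split; auto; intros y Hy Hy'.
      apply Rnot_le_lt; intro; apply N'; eauto. }
    destruct K' as (r' & Hr' & K').
    exists (b, Rmin r r'); cbn [fst snd]; repeat split; auto using Rmin_pos.
    - apply K; eapply Rlt_le_trans; [eassumption|apply Rmin_l].
    - apply K'; eapply Rlt_le_trans; [eassumption|apply Rmin_r]. }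
  destruct (choice _ Hp) as [p Kp].
  exists (fun x => snd (p x)); split; [intro x; apply Kp|intros x y Hx Hy].
  destruct (Kp x) as (Ix & _ & Cx), (Kp y) as (Iy & _ & Cy).
  rewrite pdist_sym in Hy.
  destruct (Cx y Hx) as [Ny _], (Cy x Hy) as [Nx K].
  apply K.
  destruct (ord_le_total (fst (p y)) (fst (p x))) as [L|L].
  - revert Ix; apply iter_antitone; auto using closed_full.
  - exfalso; apply Ny; revert Iy; apply iter_antitone; auto using closed_full.
Qed.

(** Gauges supply the Baire one clause, so membership becomes a condition on the additive derivation
    [delta] alone. *)
Lemma B1_iff lambda (f : X -> R) :
  Defs.B1 X lambda f <->
  forall e x, 0 < e -> ~ iter (delta X f e) (oexp lambda) (fullset X) x.
Proof.
  split.
  - intros [_ H] e x He Hx.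
    destruct (H e He) as (a & Ha & K); apply (K x).
    apply (iter_antitone X (delta X f e) a) in Hx; auto using derivation_delta, closed_full.
    revert Hx; apply iter_le; auto using derivation_delta, closed_full.
    + intros P Q HPQ y [Hy L]; split; auto.
      intros r Hr; destruct (L r Hr) as (x1 & x2 & H1 & H2 & H3); exists x1, x2; auto.
    + intros P HP _ y Hy; split.
      * now apply (der_incl X _ (derivation_delta X f e)).
      * intros r Hr; destruct (Hy (r / 2)) as (z & [Hz L] & Hd); [lra|].
        destruct (L (r / 2)) as (w & Hw & Hd' & E); [lra|].
        exists w, z; repeat split; auto; [|lra].
        pose proof (pdist_tri X y z w); lra.
  - intro H; split.
    + apply Baire1_of_gauges; intros e He; apply gauge_of_rank with (oexp lambda); auto.
    + intros e He; exists (oexp lambda); split; [apply ord_le_refl|].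
      (* Of two values e apart, one is at least e / 2 away from f x. *)
      intros x Hx; apply (H (e / 2) x); [lra|].
      clear H; revert x Hx; induction (oexp lambda) as [|a IH|g IH]; simpl; auto.
      intros x [Hx K]; apply closure_incl; split; auto.
      intros r Hr; destruct (K r Hr) as (x1 & x2 & H1 & H2 & D1 & D2 & E).
      destruct (Rle_or_lt (e / 2) (Rabs (f x1 - f x))) as [L|L]; [exists x1; auto|].
      exists x2; repeat split; auto.
      replace (f x1 - f x2) with ((f x1 - f x) + - (f x2 - f x)) in E by ring.
      pose proof (Rabs_triang (f x1 - f x) (- (f x2 - f x))) as T.
      rewrite Rabs_Ropp in T; lra.
Qed.
End Gauge.

(** * Gluing along a convergent sequence, and necessity *)

Section Gluing.
Variable X : PolishSpace.
Implicit Types (x y z w : X) (f g F : X -> R).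

(** Away from the root, F is locally one of the pieces, so its derivations there are theirs; near
    the root only late pieces occur. The support bound lets F serve as a piece of a larger
    gluing. *)
Record glued x (c rad : R) (y : nat -> X) (f : nat -> X -> R) F : Prop := {
  glued_root : F x = c;
  glued_ne : forall k, y k <> x;
  glued_cvg : forall r, 0 < r -> exists N, forall k, (N <= k)%nat -> pdist X x (y k) < r;
  glued_at : forall k, exists rho, 0 < rho /\ forall w, pdist X (y k) w < rho -> F w = f k w;
  glued_local : forall z, z <> x ->
    exists rho k, 0 < rho /\ forall w, pdist X z w < rho -> F w = f k w;
  glued_tail : forall N, exists r, 0 < r /\ forall z, z <> x -> pdist X x z < r ->
    exists k, (N <= k)%nat /\ F z = f k z;
  glued_supp : forall z, F z <> 0 -> pdist X x z <= rad
}.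

Section Construction.
Variables (x : X) (c rad : R) (y : nat -> X) (f : nat -> X -> R).
Hypothesis Hne : forall k, y k <> x.
Let D k := pdist X x (y k).
Hypothesis Hrad : D 0%nat < rad / 2.
Hypothesis Hdec : forall k, D (S k) < D k / 4.
Hypothesis Hsupp : forall k z, f k z <> 0 -> pdist X (y k) z <= D k / 4.

Let ball k z := pdist X (y k) z < D k / 2.

(** The k-th ball lies in the annulus between D k / 2 and 3 D k / 2. These annuli are disjoint
    because D shrinks by more than a factor 4, so the index picked by description is unique. *)
Definition glue_fun z : R :=
  if excluded_middle_informative (z = x) then c
  else match excluded_middle_informative (exists k, ball k z) with
       | left H => f (proj1_sig (constructive_indefinite_description _ H)) z
       | right _ => 0
       end.

Let Dpos k : 0 < D k.
Proof. apply pdist_pos; intro E; now apply (Hne k). Qed.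

Let Dmono j k : (j <= k)%nat -> D k <= D j.
Proof. induction 1 as [|k _ IH]; [lra|]; pose proof (Hdec k); pose proof (Dpos k); lra. Qed.

Let Dsmall r : 0 < r -> exists N, forall k, (N <= k)%nat -> D k < r.
Proof.
  intro Hr.
  assert (B : forall k, D k <= rad / 2 * (/ 2) ^ k).
  { induction k as [|k IH]; simpl; [lra|]; pose proof (Hdec k); pose proof (Dpos k); lra. }
  pose proof (Dpos 0%nat).
  destruct (pow_lt_1_zero (/ 2)) with (y := r / (rad / 2)) as [N HN];
    [rewrite Rabs_pos_eq; lra|apply Rdiv_lt_0_compat; lra|].
  exists N; intros k Hk; eapply Rle_lt_trans; [apply B|].
  specialize (HN k Hk); rewrite Rabs_pos_eq in HN by (apply pow_le; lra).
  replace r with (rad / 2 * (r / (rad / 2))) by (field; lra).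
  apply Rmult_lt_compat_l; lra.
Qed.

Let ball_dist k z : ball k z -> D k / 2 < pdist X x z < 3 / 2 * D k.
Proof.
  intro H; unfold ball in H.
  pose proof (pdist_tri X x (y k) z); pose proof (pdist_tri X x z (y k)) as T.
  rewrite (pdist_sym X z (y k)) in T; fold (D k) in *; lra.
Qed.

Let ball_uniq j k z : ball j z -> ball k z -> j = k.
Proof.
  assert (L : forall j k, (j < k)%nat -> ball j z -> ~ ball k z).
  { intros j' k' Hjk Hj%ball_dist Hk%ball_dist.
    pose proof (Dmono _ _ Hjk); pose proof (Hdec j'); lra. }
  intros Hj Hk; destruct (Nat.lt_trichotomy j k) as [H|[H|H]]; auto;
    exfalso; eapply L; eauto.
Qed.

Let glue_ball k z : ball k z -> glue_fun z = f k z.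
Proof.
  intro H; unfold glue_fun.
  destruct excluded_middle_informative as [->|_].
  { apply ball_dist in H; rewrite pdist_refl in H; pose proof (Dpos k); lra. }
  destruct excluded_middle_informative as [E|N]; [|exfalso; eauto].
  destruct constructive_indefinite_description as [j Hj]; cbn.
  now rewrite (ball_uniq _ _ _ Hj H).
Qed.

Let glue_out z : z <> x -> (forall k, ~ ball k z) -> glue_fun z = 0.
Proof.
  intros Hz N; unfold glue_fun.
  destruct excluded_middle_informative as [|_]; [contradiction|].
  destruct excluded_middle_informative as [[k Hk]|_]; [exfalso; eapply N; eauto|auto].
Qed.

Let supp_ball k z : D k / 4 < pdist X (y k) z -> f k z = 0.
Proof. intro H; apply NNPP; intro N; apply Hsupp in N; lra. Qed.

Lemma glued_glue_fun : glued x c rad y f glue_fun.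
Proof.
  split; auto.
  - unfold glue_fun; destruct excluded_middle_informative; [auto|contradiction].
  - intro k; exists (D k / 2); split; [pose proof (Dpos k); lra|].
    intros w Hw; now apply glue_ball.
  - intros z Hz.
    destruct (classic (exists k, ball k z)) as [[k Hk]|N].
    + exists (D k / 2 - pdist X (y k) z), k; split; [unfold ball in Hk; lra|].
      intros w Hw; apply glue_ball; unfold ball.
      pose proof (pdist_tri X (y k) z w); lra.
    + assert (Hz0 : 0 < pdist X x z) by (apply pdist_pos; auto).
      destruct (Dsmall (pdist X x z / 8)) as [K HK]; [lra|].
      (* Near a point outside all balls every piece vanishes: those from K on are supported too
         close to x, and each earlier one leaves a margin of D k / 4 between support and ball. *)
      assert (Z : forall k w, pdist X z w < pdist X x z / 2 -> pdist X z w < D K / 8 -> f k w = 0).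
      { intros k w H1 H2; apply supp_ball.
        destruct (Nat.le_gt_cases K k) as [H|H].
        - specialize (HK k H).
          pose proof (pdist_tri X x w z); pose proof (pdist_tri X x (y k) w).
          rewrite (pdist_sym X w z) in *; fold (D k) in *; lra.
        - pose proof (Dmono k K ltac:(lia)).
          assert (D k / 2 <= pdist X (y k) z)
            by (apply Rnot_lt_le; intro; apply N; now exists k).
          pose proof (pdist_tri X (y k) w z); rewrite (pdist_sym X w z) in *.
          pose proof (Dpos k); lra. }
      exists (Rmin (pdist X x z / 2) (D K / 8)), K; split.
      * apply Rmin_pos; pose proof (Dpos K); lra.
      * intros w Hw.
        assert (W1 : pdist X z w < pdist X x z / 2)
          by (eapply Rlt_le_trans; [exact Hw|apply Rmin_l]).
        assert (W2 : pdist X z w < D K / 8)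
          by (eapply Rlt_le_trans; [exact Hw|apply Rmin_r]).
        rewrite (Z K w W1 W2).
        destruct (classic (exists k, ball k w)) as [[k Hk]|N'].
        -- rewrite (glue_ball k w Hk); auto.
        -- apply glue_out; [|eauto].
           intros ->; rewrite (pdist_sym X z x) in W1; lra.
  - intro N; exists (D N / 2); split; [pose proof (Dpos N); lra|].
    intros z Hz Hd; destruct (classic (exists k, ball k z)) as [[k Hk]|Nk].
    + exists k; split; [|now apply glue_ball].
      apply ball_dist in Hk; apply Nat.nlt_ge; intro L.
      pose proof (Dmono k N ltac:(lia)); lra.
    + exists N; split; auto; rewrite glue_out by eauto; symmetry; apply supp_ball.
      assert (D N / 2 <= pdist X (y N) z)
        by (apply Rnot_lt_le; intro; apply Nk; now exists N).
      pose proof (Dpos N); lra.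
  - intros z Hz; destruct (classic (z = x)) as [->|Nz].
    + rewrite pdist_refl; pose proof (Dpos 0); lra.
    + destruct (classic (exists k, ball k z)) as [[k Hk]|N].
      * apply ball_dist in Hk; pose proof (Dmono 0 k ltac:(lia)); lra.
      * exfalso; apply Hz, glue_out; eauto.
Qed.
End Construction.

(** Each child is chosen within a quarter of the distance of the previous one. The support condition
    is relative to the child's distance from x, known only after the choice. *)
Lemma glue_exists x (c rad : R) (Q : nat -> X -> (X -> R) -> Prop) : 0 < rad ->
  (forall k r, 0 < r -> exists y f, y <> x /\ pdist X x y < r /\ Q k y f /\
     forall z, f z <> 0 -> pdist X y z <= pdist X x y / 4) ->
  exists (y : nat -> X) (f : nat -> X -> R) F, glued x c rad y f F /\ forall k, Q k (y k) (f k).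
Proof.
  intros Hrad H.
  assert (H' : forall kr : nat * R, exists p : X * (X -> R), 0 < snd kr ->
     fst p <> x /\ pdist X x (fst p) < snd kr /\ Q (fst kr) (fst p) (snd p) /\
     forall z, snd p z <> 0 -> pdist X (fst p) z <= pdist X x (fst p) / 4).
  { intros [k r]; destruct (classic (0 < r)) as [Hr|N].
    - destruct (H k r Hr) as (y & f & K); exists (y, f); auto.
    (* Dummy value making the choice function total; the recursion only asks for positive radii. *)
    - exists (x, fun _ => 0); intro; contradiction. }
  destruct (choice _ H') as [ch Hch]; clear H H'.
  set (p := fix p (k : nat) : X * (X -> R) := match k with
    | O => ch (O, rad / 2)
    | S j => ch (S j, pdist X x (fst (p j)) / 4) end).
  assert (Hp : forall k, fst (p k) <> x /\ Q k (fst (p k)) (snd (p k)) /\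
     (forall z, snd (p k) z <> 0 -> pdist X (fst (p k)) z <= pdist X x (fst (p k)) / 4)).
  { induction k as [|k (IH & _)].
    - destruct (Hch (O, rad / 2) ltac:(cbn; lra)) as (A1 & _ & A2 & A3); auto.
    - assert (0 < pdist X x (fst (p k))) by (apply pdist_pos; auto).
      destruct (Hch (S k, pdist X x (fst (p k)) / 4) ltac:(cbn; lra)) as (A1 & _ & A2 & A3); auto. }
  exists (fun k => fst (p k)), (fun k => snd (p k)),
    (glue_fun x c (fun k => fst (p k)) (fun k => snd (p k))); split; [|intro k; apply Hp].
  apply glued_glue_fun.
  - intro k; apply Hp.
  - apply (Hch (O, rad / 2)); cbn; lra.
  - intro k; assert (0 < pdist X x (fst (p k))) by (apply pdist_pos, not_eq_sym, Hp).
    apply (Hch (S k, pdist X x (fst (p k)) / 4)); cbn; lra.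
  - intro k; apply Hp.
Qed.

(** Both the closure and the oscillation condition look only at arbitrarily small neighbourhoods, so
    all witnesses can be kept inside the ball. *)
Lemma delta_local f g e a z rho :
  (forall w, pdist X z w < rho -> f w = g w) ->
  forall w, pdist X z w < rho ->
  iter (delta X f e) a (fullset X) w -> iter (delta X g e) a (fullset X) w.
Proof.
  intros H; induction a as [|a IH|s IH]; intros w Hw Hi; auto.
  - intros r Hr.
    destruct (Hi (Rmin r (rho - pdist X z w))) as (u & [Hu K] & Hd); [apply Rmin_pos; lra|].
    assert (Hd1 : pdist X w u < r) by (eapply Rlt_le_trans; [exact Hd|apply Rmin_l]).
    assert (Hd2 : pdist X w u < rho - pdist X z w)
      by (eapply Rlt_le_trans; [exact Hd|apply Rmin_r]).
    assert (Hzu : pdist X z u < rho) by (pose proof (pdist_tri X z w u); lra).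
    exists u; split; auto; split; auto.
    intros r' Hr'.
    destruct (K (Rmin r' (rho - pdist X z u))) as (v & Hv & Hdv & E); [apply Rmin_pos; lra|].
    assert (Hd3 : pdist X u v < r') by (eapply Rlt_le_trans; [exact Hdv|apply Rmin_l]).
    assert (Hd4 : pdist X u v < rho - pdist X z u)
      by (eapply Rlt_le_trans; [exact Hdv|apply Rmin_r]).
    assert (Hzv : pdist X z v < rho) by (pose proof (pdist_tri X z u v); lra).
    exists v; repeat split; auto.
    rewrite <- (H u Hzu), <- (H v Hzv); exact E.
  - intro n; apply IH; auto.
Qed.

Lemma delta_const f e P v : 0 < e -> (forall x, P x -> f x = v) -> forall x, ~ delta X f e P x.
Proof.
  intros He H x Hx; destruct (Hx 1 Rlt_0_1) as (y & [Hy K] & _).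
  destruct (K 1 Rlt_0_1) as (z & Hz & _ & E).
  rewrite (H y Hy), (H z Hz), Rminus_diag, Rabs_R0 in E; lra.
Qed.

(** Removes the closure at the cost of halving e: if z is close to x and w is an e-partner of z,
    then z or w is an e/2-partner of x. *)
Lemma delta_incl_Oset f e P : closed X P -> incl (delta X f e P) (Oset X f (e / 2) P).
Proof.
  intros HP x Hx; split; [now apply (der_incl X _ (derivation_delta X f e))|].
  intros r Hr; destruct (Hx (r / 2)) as (z & [Hz K] & Hd); [lra|].
  destruct (K (r / 2)) as (w & Hw & Hd' & E); [lra|].
  destruct (Rle_or_lt (e / 2) (Rabs (f z - f x))) as [L|L].
  - exists z; repeat split; auto; lra.
  - exists w; repeat split; auto.
    + pose proof (pdist_tri X x z w); lra.
    + replace (f w - f z) with ((f w - f x) + - (f z - f x)) in E by ring.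
      pose proof (Rabs_triang (f w - f x) (- (f z - f x))) as T.
      rewrite Rabs_Ropp in T; lra.
Qed.

Section Glued.
Variables (x : X) (c rad : R) (y : nat -> X) (f : nat -> X -> R) (F : X -> R).
Hypothesis HF : glued x c rad y f F.

Lemma glued_delta a e z : z <> x -> iter (delta X F e) a (fullset X) z ->
  exists k, F z = f k z /\ iter (delta X (f k) e) a (fullset X) z.
Proof.
  intros Hz Hi; destruct (glued_local _ _ _ _ _ _ HF z Hz) as (rho & k & Hrho & E).
  exists k; split; [apply E; now rewrite pdist_refl|].
  apply (delta_local F (f k) e a z rho); auto; now rewrite pdist_refl.
Qed.

Variables (h : X -> R) (b : nat -> ord).
Hypothesis Hb : nondecr b.
Hypothesis Hy : forall k, iter (delta X (fun z => h z * f k z) 1) (b k) (fullset X) (y k).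

Lemma glued_child k m : (m <= k)%nat ->
  iter (delta X (fun z => h z * F z) 1) (b m) (fullset X) (y k).
Proof.
  intro Hm; apply (iter_antitone X _ (b m) (b k));
    auto using derivation_delta, closed_full.
  destruct (glued_at _ _ _ _ _ _ HF k) as (rho & Hrho & E).
  apply (delta_local (fun z => h z * f k z) _ 1 (b k) (y k) rho); auto.
  - intros w Hw; now rewrite (E w Hw).
  - now rewrite pdist_refl.
Qed.

Lemma glued_limit m : iter (delta X (fun z => h z * F z) 1) (b m) (fullset X) x.
Proof.
  apply closed_iter; [apply derivation_delta|apply closed_full|].
  intros r Hr; destruct (glued_cvg _ _ _ _ _ _ HF r Hr) as [N HN].
  exists (y (Nat.max N m)); split; [apply glued_child; lia|apply HN; lia].
Qed.

(** The root lies in every stage b m as a limit of later children, and the jump of [h F] along these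
    children carries it one stage further. *)
Lemma glued_succ : (forall k, 1 <= Rabs (h (y k) * f k (y k) - h x * c)) ->
  iter (delta X (fun z => h z * F z) 1) (OL (fun k => OS (b k))) (fullset X) x.
Proof.
  intros Hv m; apply closure_incl; split; [apply glued_limit|].
  intros r Hr; destruct (glued_cvg _ _ _ _ _ _ HF r Hr) as [N HN].
  exists (y (Nat.max N m)); split; [apply glued_child; lia|split; [apply HN; lia|]].
  destruct (glued_at _ _ _ _ _ _ HF (Nat.max N m)) as (rho & Hrho & E).
  rewrite (E (y (Nat.max N m))) by now rewrite pdist_refl.
  rewrite (glued_root _ _ _ _ _ _ HF); apply Hv.
Qed.
End Glued.

(** * Functions on trees of surviving points, and the two necessary conditions *)

Definition spike x (c : R) : X -> R :=
  fun z => if excluded_middle_informative (z = x) then c else 0.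

Lemma spike_at x c : spike x c x = c.
Proof. unfold spike; destruct excluded_middle_informative; [auto|contradiction]. Qed.

Lemma spike_out x c z : z <> x -> spike x c z = 0.
Proof. intro; unfold spike; destruct excluded_middle_informative; [contradiction|auto]. Qed.

Lemma spike_delta x c e P : 0 < e -> incl (delta X (spike x c) e P) (fun z => z = x).
Proof.
  intros He z Hz; apply NNPP; intro N.
  assert (Hp : 0 < pdist X z x) by now apply pdist_pos.
  destruct (Hz (pdist X z x / 2)) as (u & [_ K] & Hu); [lra|].
  destruct (K (pdist X z x / 2)) as (v & _ & Hv & E); [lra|].
  rewrite !spike_out, Rminus_diag, Rabs_R0 in E; [lra| |].
  - intros ->; lra.
  - intros ->; pose proof (pdist_tri X z u x); lra.
Qed.

(** Values 0 and 1/h alternate between levels, so [h f] jumps by exactly 1 along each edge, while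
    |h| > M where f is nonzero gives |f| <= 1/M. All points but the root are gone after b + 1 steps,
    whence rank at most b + 2. *)
Lemma bounded_tree h M b : 0 < M ->
  forall x r c, iter (hM X h M) b (fullset X) x -> 0 < r ->
  c = 0 \/ (c * h x = 1 /\ M < Rabs (h x)) ->
  exists f, f x = c /\ (forall z, f z <> 0 -> pdist X x z <= r) /\
    (forall z, Rabs (f z) <= / M) /\
    iter (delta X (fun z => h z * f z) 1) b (fullset X) x /\
    forall e z, 0 < e -> ~ iter (delta X f e) (OS (OS b)) (fullset X) z.
Proof.
  intro HM; induction b as [b IH] using (well_founded_ind ord_lt_wf).
  intros x r c Hx Hr Hc.
  assert (HMinv : 0 < / M) by now apply Rinv_0_lt_compat.
  assert (Hcb : forall z c, c = 0 \/ (c * h z = 1 /\ M < Rabs (h z)) -> Rabs c <= / M).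
  { clear -HM HMinv; intros z c [->|[E L]]; [rewrite Rabs_R0; lra|].
    apply Rmult_le_reg_r with M; auto; rewrite Rinv_l by lra.
    rewrite <- Rabs_R1, <- E, Rabs_mult; apply Rmult_le_compat_l; [apply Rabs_pos|lra]. }
  destruct (ord_decomp b) as [Hb0|(b' & Hmono & Hb1 & Hb2)].
  - exists (spike x c); split; [apply spike_at|split; [|split; [|split]]].
    + intros z Hz; destruct (classic (z = x)) as [->|N]; [rewrite pdist_refl; lra|].
      exfalso; now apply Hz, spike_out.
    + intro z; destruct (classic (z = x)) as [->|N].
      * rewrite spike_at; eauto.
      * rewrite spike_out, Rabs_R0 by auto; lra.
    + apply (iter_antitone X _ b OZ); auto using derivation_delta, closed_full; exact I.
    + intros e z He Hz.
      apply (delta_const (spike x c) e (fun z => z = x) c He) with z; [intros ? ->; apply spike_at|].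
      revert Hz; apply (der_mono X _ (derivation_delta X _ _)), spike_delta, He.
  - assert (Hlt : forall k, ord_le (OS (b' k)) b)
      by (intro k; eapply ord_le_trans; [apply (ord_le_L (fun k => OS (b' k)) k)|exact Hb2]).
    set (Q := fun k y (f : X -> R) =>
      1 <= Rabs (h y * f y - h x * c) /\ (forall z, Rabs (f z) <= / M) /\
      iter (delta X (fun z => h z * f z) 1) (b' k) (fullset X) y /\
      forall e z, 0 < e -> ~ iter (delta X f e) (OS (OS (b' k))) (fullset X) z).
    destruct (glue_exists x c r Q Hr) as (y & f & F & HF & HQ).
    { intros k r' Hr'.
      assert (Hxk : hM X h M (iter (hM X h M) (b' k) (fullset X)) x).
      { apply (iter_antitone X _ (OS (b' k)) b) in Hx; auto using derivation_hM, closed_full. }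
      destruct (Hxk r' Hr') as (y & [Hy HhM] & Hne & Hd).
      assert (Hy0 : h y <> 0) by (intro E; rewrite E, Rabs_R0 in HhM; lra).
      (* The child receives the value of the opposite kind. *)
      assert (Hc' : exists c', (c' = 0 \/ (c' * h y = 1 /\ M < Rabs (h y))) /\
                      Rabs (h y * c' - h x * c) = 1).
      { destruct Hc as [->|[E _]].
        - exists (/ h y); split; [right; split; auto; now apply Rinv_l|].
          rewrite Rinv_r, Rmult_0_r, Rminus_0_r by auto; apply Rabs_R1.
        - exists 0; split; auto.
          rewrite Rmult_0_r, Rmult_comm, E, Rminus_0_l, Rabs_Ropp; apply Rabs_R1. }
      destruct Hc' as (c' & Hc' & Hval).
      assert (Hpos : 0 < pdist X x y) by (apply pdist_pos; auto).
      destruct (IH (b' k) (Hlt k) y (pdist X x y / 4) c' Hy ltac:(lra) Hc')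
        as (f & Hf1 & Hf2 & Hf3 & Hf4 & Hf5).
      exists y, f; split; [auto|split; [auto|split; [|auto]]].
      split; [rewrite Hf1, Hval; lra|auto]. }
    exists F; split; [apply (glued_root _ _ _ _ _ _ HF)|split; [|split; [|split]]].
    + apply (glued_supp _ _ _ _ _ _ HF).
    + intro z; destruct (classic (z = x)) as [->|N].
      * rewrite (glued_root _ _ _ _ _ _ HF); eauto.
      * destruct (glued_local _ _ _ _ _ _ HF z N) as (rho & k & Hrho & E).
        rewrite E by now rewrite pdist_refl.
        apply (HQ k).
    + apply (iter_antitone X _ b (OL (fun k => OS (b' k))));
        auto using derivation_delta, closed_full.
      apply (glued_succ x c r y f F HF); auto; intro k; apply (HQ k).
    + intros e z He Hz.
      apply (delta_const F e (fun z => z = x) c He) with z.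
      { intros ? ->; apply (glued_root _ _ _ _ _ _ HF). }
      revert z Hz; apply (der_mono X _ (derivation_delta X _ _)).
      intros z Hz; apply NNPP; intro N.
      destruct (glued_delta _ _ _ _ _ _ HF (OS b) e z N Hz) as (k & _ & K).
      destruct (HQ k) as (_ & _ & _ & Q4); apply (Q4 e z He).
      revert K; apply iter_antitone; auto using derivation_delta, closed_full.
      apply ole_SS, Hlt.
Qed.

(** The k-th child of [x] carries a tree built for M = k + 1, so F tends to 0 at [x] and the root
    adds nothing to the rank of F, while [h F] jumps by 1 at every stage. *)
Lemma hM_necessary h kappa : ~ ord_eq kappa OZ -> Mclass X kappa kappa h ->
  forall x, ~ (forall M, 0 < M -> iter (hM X h M) (oexp kappa) (fullset X) x).
Proof.
  intros Hk HM x Hx.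
  destruct (ord_decomp (oexp kappa)) as [H0|(b & Hmono & Hb1 & Hb2)].
  { pose proof (ord_le_trans _ _ _ (oexp_ge_1 kappa) H0) as E; inversion E. }
  assert (Hlt : forall k, ord_le (OS (b k)) (oexp kappa))
    by (intro k; eapply ord_le_trans; [apply (ord_le_L (fun k => OS (b k)) k)|exact Hb2]).
  set (Q := fun k y (f : X -> R) =>
      h y * f y = 1 /\ (forall z, Rabs (f z) <= / INR (S k)) /\
      iter (delta X (fun z => h z * f z) 1) (b k) (fullset X) y /\
      forall e z, 0 < e -> ~ iter (delta X f e) (OS (OS (b k))) (fullset X) z).
  destruct (glue_exists x 0 1 Q Rlt_0_1) as (y & f & F & HF & HQ).
  { intros k r' Hr'.
    assert (HMk : 0 < INR (S k)) by (apply lt_0_INR; lia).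
    assert (Hxk : hM X h (INR (S k)) (iter (hM X h (INR (S k))) (b k) (fullset X)) x).
    { specialize (Hx _ HMk).
      apply (iter_antitone X _ (OS (b k)) (oexp kappa)) in Hx;
        auto using derivation_hM, closed_full. }
    destruct (Hxk r' Hr') as (y & [Hy HhM] & Hne & Hd).
    assert (Hy0 : h y <> 0) by (intro E; rewrite E, Rabs_R0 in HhM; lra).
    assert (Hpos : 0 < pdist X x y) by (apply pdist_pos; auto).
    destruct (bounded_tree h (INR (S k)) (b k) HMk y (pdist X x y / 4) (/ h y) Hy)
      as (f & Hf1 & Hf2 & Hf3 & Hf4 & Hf5); [lra|right; split; auto; now apply Rinv_l|].
    exists y, f; split; [auto|split; [auto|split; [|auto]]].
    split; [rewrite Hf1; now apply Rinv_r|auto]. }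
  assert (HB : Defs.B1 X kappa F).
  { apply B1_iff; intros e z He Hz.
    destruct (classic (z = x)) as [->|N].
    - apply (iter_antitone X _ (OS OZ)) in Hz;
        auto using derivation_delta, closed_full, oexp_ge_1.
      (* Near the root |F| < e / 2, so the root is lost at the first step. *)
      destruct (archimed_cor1 (e / 2)) as (N & HN & HN0); [lra|].
      destruct (glued_tail _ _ _ _ _ _ HF N) as (r & Hr & Ht).
      assert (Hsmall : forall z, pdist X x z < r -> Rabs (F z) < e / 2).
      { intros z Hz'; destruct (classic (z = x)) as [->|Nz].
        - rewrite (glued_root _ _ _ _ _ _ HF), Rabs_R0; lra.
        - destruct (Ht z Nz Hz') as (k & Hk' & ->).
          destruct (HQ k) as (_ & Q2 & _).
          eapply Rle_lt_trans; [apply Q2|].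
          eapply Rle_lt_trans; [|exact HN].
          apply Rinv_le_contravar; [now apply lt_0_INR|apply le_INR; lia]. }
      destruct (Hz (r / 2)) as (u & [_ K] & Hu); [lra|].
      destruct (K (r / 2)) as (v & _ & Hv & E); [lra|].
      pose proof (Hsmall u ltac:(lra)).
      pose proof (Hsmall v ltac:(pose proof (pdist_tri X x u v); lra)).
      pose proof (Rabs_triang (F v) (- F u)) as T; rewrite Rabs_Ropp in T.
      unfold Rminus in E; lra.
    - destruct (glued_delta _ _ _ _ _ _ HF _ e z N Hz) as (k & _ & K).
      destruct (HQ k) as (_ & _ & _ & Q4); apply (Q4 e z He).
      revert K; apply iter_antitone; auto using derivation_delta, closed_full.
      apply oexp_limit; [auto|apply Hlt]. }
  apply HM in HB; rewrite B1_iff in HB; apply (HB 1 x Rlt_0_1).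
  apply (iter_antitone X _ _ (OL (fun k => OS (b k)))); auto using derivation_delta, closed_full.
  apply (glued_succ x 0 1 y f F HF); auto; intro k; [apply (HQ k)|].
  destruct (HQ k) as [-> _]; rewrite Rmult_0_r, Rminus_0_r, Rabs_R1; lra.
Qed.

(** Outer induction on the number g of [Omega] steps, inner on the number of [delta] steps on top of
    them. Inner steps keep eta and hence the value 2 / eta, so they cost f no rank: the third clause
    does not depend on sig. The product nevertheless gains sig stages from them and a factor lam per
    [Omega] step. *)
Lemma Omega_tree h s lam :
  (forall n, ord_lt (s n) (s (S n))) -> ord_eq (OL s) lam ->
  forall (g sig : ord) y eta r, 0 < eta -> 0 < r ->
  iter (delta X h eta) sig (iter (Omega X h s) g (fullset X)) y ->
  exists f, f y = 2 / eta /\ (forall z, f z <> 0 -> pdist X y z <= r) /\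
    (forall e z, 0 < e -> iter (delta X f e) (OS g) (fullset X) z -> f z = 2 / eta) /\
    iter (delta X (fun z => h z * f z) 1) (oadd (omul lam g) sig) (fullset X) y.
Proof.
  intros Hinc Hlim.
  assert (Hsm : nondecr s) by (apply nondecr_step; intro n; apply ord_le_S_l, Hinc).
  induction g as [g IHg] using (well_founded_ind ord_lt_wf).
  induction sig as [sig IHs] using (well_founded_ind ord_lt_wf).
  intros x eta r Heta Hr Hx.
  assert (HPc : closed X (iter (Omega X h s) g (fullset X)))
    by auto using closed_iter, derivation_Omega, closed_full.
  destruct (ord_decomp sig) as [Hs0|(b & Hmono & Hb1 & Hb2)].
  - assert (HxO : iter (Omega X h s) g (fullset X) x)
      by (revert Hx; apply iter_incl; auto using derivation_delta).
    destruct (ord_decomp g) as [Hg0|(b & Hmono & Hb1 & Hb2)].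
    + exists (spike x (2 / eta)); split; [apply spike_at|split; [|split]].
      * intros z Hz; destruct (classic (z = x)) as [->|N]; [rewrite pdist_refl; lra|].
        exfalso; now apply Hz, spike_out.
      * intros e z He Hz; apply spike_delta in Hz; auto; subst z; apply spike_at.
      * apply (iter_antitone X _ _ OZ); auto using derivation_delta, closed_full; [|exact I].
        eapply ord_le_trans; [apply oadd_le_r, Hs0|].
        exact (omul_le_r lam g OZ Hg0).
    + assert (Hlt : forall k, ord_le (OS (b k)) g)
        by (intro k; eapply ord_le_trans; [apply (ord_le_L (fun k => OS (b k)) k)|exact Hb2]).
      (* Each child comes with its own eta. No jump towards the root is required: its stages are
         obtained as limits of those of its children. *)
      set (Q := fun k y (f : X -> R) =>
        (forall e z, 0 < e -> ~ iter (delta X f e) (OS (OS (b k))) (fullset X) z) /\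
        iter (delta X (fun z => h z * f z) 1) (oadd (omul lam (b k)) (s k)) (fullset X) y).
      destruct (glue_exists x (2 / eta) r Q Hr) as (y & f & F & HF & HQ).
      { intros k r' Hr'.
        apply (iter_antitone X _ (OS (b k)) g) in HxO; auto using derivation_Omega, closed_full.
        destruct (HxO k r' Hr') as (y & (eta' & Heta' & Hy) & Hne & Hd).
        assert (Hpos : 0 < pdist X x y) by (apply pdist_pos; auto).
        destruct (IHg (b k) (Hlt k) (s k) y eta' (pdist X x y / 4) Heta' ltac:(lra) Hy)
          as (f & Hf1 & Hf2 & Hf3 & Hf4).
        exists y, f; split; [auto|split; [auto|split; [|auto]]].
        split; auto; intros e z He.
        apply delta_const with (2 / eta'); eauto. }
      assert (Hbs : nondecr (fun k => oadd (omul lam (b k)) (s k)))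
        by (intros n m Hnm; apply oadd_le; auto; apply omul_le_r; auto).
      exists F; split; [apply (glued_root _ _ _ _ _ _ HF)|split; [|split]].
      * apply (glued_supp _ _ _ _ _ _ HF).
      * intros e z He Hz; destruct (classic (z = x)) as [->|N];
          [apply (glued_root _ _ _ _ _ _ HF)|exfalso].
        destruct (glued_delta _ _ _ _ _ _ HF _ e z N Hz) as (k & _ & K).
        destruct (HQ k) as [Q1 _]; apply (Q1 e z He).
        revert K; apply iter_antitone; auto using derivation_delta, closed_full.
        apply ole_SS, Hlt.
      * apply (iter_antitone X _ _ (OL (fun k => oadd (omul lam (b k)) (s k))));
          auto using derivation_delta, closed_full.
        -- eapply ord_le_trans; [apply oadd_le_r, Hs0|].
           eapply ord_le_trans; [apply omul_le_r, Hb1|].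
           cbn [omul oadd]; apply ole_Ll; intro m.
           eapply ord_le_trans; [apply oadd_le_r, Hlim|].
           (* The double supremum over b m and s j is reached along the diagonal, both sequences
              being nondecreasing. *)
           cbn [oadd]; apply ole_Ll; intro j; apply ole_Lr with (Nat.max m j).
           apply oadd_le; [apply omul_le_r, Hmono|apply Hsm]; lia.
        -- intro m; apply (glued_limit x (2 / eta) r y f F HF h _ Hbs); intro k; apply (HQ k).
  - assert (Hlt : forall k, ord_le (OS (b k)) sig)
      by (intro k; eapply ord_le_trans; [apply (ord_le_L (fun k => OS (b k)) k)|exact Hb2]).
    set (Q := fun k y (f : X -> R) =>
      1 <= Rabs (h y * f y - h x * (2 / eta)) /\
      (forall e z, 0 < e -> iter (delta X f e) (OS g) (fullset X) z -> f z = 2 / eta) /\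
      iter (delta X (fun z => h z * f z) 1) (oadd (omul lam g) (b k)) (fullset X) y).
    destruct (glue_exists x (2 / eta) r Q Hr) as (y & f & F & HF & HQ).
    { intros k r' Hr'.
      apply (iter_antitone X _ (OS (b k)) sig) in Hx; auto using derivation_delta.
      apply delta_incl_Oset in Hx; auto using closed_iter, derivation_delta.
      destruct Hx as [_ Hx]; destruct (Hx r' Hr') as (y & Hy & Hd & E).
      assert (Hne : y <> x) by (intros ->; rewrite Rminus_diag, Rabs_R0 in E; lra).
      assert (Hpos : 0 < pdist X x y) by (apply pdist_pos; auto).
      destruct (IHs (b k) (Hlt k) y eta (pdist X x y / 4) Heta ltac:(lra) Hy)
        as (f & Hf1 & Hf2 & Hf3 & Hf4).
      exists y, f; split; [auto|split; [auto|split; [|auto]]].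
      split; auto; rewrite Hf1, <- Rmult_minus_distr_r, Rabs_mult.
      assert (H2 : 0 < 2 / eta) by (apply Rdiv_lt_0_compat; lra).
      rewrite (Rabs_pos_eq (2 / eta)) by lra.
      (* Without the closure the jump of h is only known to be eta / 2; this is why f takes the
         value 2 / eta. *)
      replace 1 with (eta / 2 * (2 / eta)) by (field; lra).
      apply Rmult_le_compat_r; lra. }
    exists F; split; [apply (glued_root _ _ _ _ _ _ HF)|split; [|split]].
    + apply (glued_supp _ _ _ _ _ _ HF).
    + intros e z He Hz; destruct (classic (z = x)) as [->|N];
        [apply (glued_root _ _ _ _ _ _ HF)|].
      destruct (glued_delta _ _ _ _ _ _ HF _ e z N Hz) as (k & -> & K).
      destruct (HQ k) as (_ & Q2 & _); eauto.
    + apply (iter_antitone X _ _ (OL (fun k => OS (oadd (omul lam g) (b k)))));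
        auto using derivation_delta, closed_full.
      * exact (oadd_le_r (omul lam g) _ _ Hb1).
      * apply (glued_succ x (2 / eta) r y f F HF).
        -- intros n m Hnm; apply oadd_le_r; auto.
        -- intro k; apply (HQ k).
        -- intro k; apply (HQ k).
Qed.

(** The tree is used with no [delta] steps at the root and the arbitrary value eta = 1. Then f dies
    after omega^alpha + 2 steps, whereas [h f] survives omega^(omega^xi) omega^alpha = omega^kappa
    of them. *)
Lemma Omega_necessary h s kappa xi alpha :
  (forall n, ord_lt (s n) (s (S n))) -> ord_eq (OL s) (oexp (oexp xi)) ->
  ord_eq kappa (oadd (oexp xi) alpha) -> ord_lt alpha kappa -> Mclass X kappa kappa h ->
  forall x, ~ iter (Omega X h s) (oexp alpha) (fullset X) x.
Proof.
  intros Hinc Hlim Hk Hlt HM x Hx.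
  destruct (Omega_tree h s _ Hinc Hlim (oexp alpha) OZ x 1 1 Rlt_0_1 Rlt_0_1 Hx)
    as (f & _ & _ & Hf & Hi).
  assert (HB : Defs.B1 X kappa f).
  { apply B1_iff; intros e z He Hz.
    apply (iter_antitone X _ (OS (OS (oexp alpha)))) in Hz;
      auto using derivation_delta, closed_full, oexp_add_2_le.
    revert Hz; apply delta_const with (2 / 1); eauto. }
  apply HM in HB; rewrite B1_iff in HB; apply (HB 1 x Rlt_0_1).
  revert Hi; apply iter_antitone; auto using derivation_delta, closed_full.
  eapply ord_le_trans; [apply oexp_le, Hk|apply oexp_oadd].
Qed.
End Gluing.

Theorem theorem4p18 (X : PolishSpace) (h : X -> R) (kappa xi alpha : ord)
  (s : nat -> ord)
  (Hk : ~ ord_eq kappa OZ)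
  (Hsim : cnf_sim kappa xi alpha)
  (Hs_inc : forall n, ord_lt (s n) (s (S n)))
  (Hs_lim : ord_eq (OL s) (oexp (oexp xi))) :
  Mclass X kappa kappa h <->
  ((forall x : X, ~ (forall M, 0 < M -> iter (hM X h M) (oexp kappa) (fullset X) x)) /\
   (forall x : X, ~ iter (Omega X h s) (oexp alpha) (fullset X) x)).
Proof.
  destruct (cnf_sim_split _ _ _ Hsim) as [Heq Hlt].
  split.
  - intro HM; split.
    + now apply hM_necessary.
    + now apply Omega_necessary with kappa xi.
  - intros [H1 H2] f Hf; rewrite B1_iff in *.
    now apply mul_delta_empty with xi alpha s.
Qed.
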